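(* Let $\Omega\subset\mathbb{R}^d$ ($d\ge 1$) be a connected open set with Lipschitz boundary, let $\Gamma_D,\Gamma_N$ be disjoint subsets of $\partial\Omega$ with $\partial\Omega=\Gamma_D\cup\Gamma_N$ and $\Gamma_D$ of non-zero $(d-1)$-dimensional measure, and let $\mathbf{F}\in \mathbf{L}^2(\Omega)$, $\mathbf{g}\in \mathbf{L}^2(\Gamma_N)$. Let $\mathbb{C}:\Omega\to\mathbb{R}^{d^4}$ be measurable, each $\mathbb{C}(x)$ being viewed as a linear map $\mathbb{R}^{d\times d}\to\mathbb{R}^{d\times d}$, and suppose there are $\sigma^*,\sigma_*>0$ such that, for a.e. $x\in\Omega$ and all $\boldsymbol\tau,\boldsymbol\omega\in\mathbb{R}^{d\times d}$: $\mathbb{C}(x)\boldsymbol\tau:\boldsymbol\omega=\boldsymbol\tau:\mathbb{C}(x)\boldsymbol\omega$, $(\mathbb{C}(x)\boldsymbol\tau)^T=\mathbb{C}(x)\boldsymbol\tau^T$, $|\mathbb{C}(x)|\le\sigma^*$, and $\mathbb{C}(x)\boldsymbol\tau:\boldsymbol\tau\ge\sigma_*|\boldsymbol\tau|^2$. Let $\overline{\mathbf{u}}\in \mathbf{H}^1_{\Gamma_D}(\Omega)$ be the solution of: for all $\mathbf{v}\in\mathbf{H}^1_{\Gamma_D}(\Omega)$, $$\int_\Omega \mathbb{C}\,\boldsymbol\varepsilon(\overline{\mathbf{u}}):\boldsymbol\varepsilon(\mathbf{v})\,dx=\int_\Omega\mathbf{F}\cdot\mathbf{v}\,dx+\int_{\Gamma_N}\mathbf{g}\cdot\gamma(\mathbf{v})\,dS$$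 (note that $\mathbb{C}\boldsymbol\varepsilon(\overline{\mathbf{u}})\in\mathbf{H}_{\operatorname{div}}(\Omega,\Gamma_N)$ since $\mathbf{F}\in\mathbf{L}^2(\Omega)$ and $\mathbf{g}\in\mathbf{L}^2(\Gamma_N)$). If $\mathcal{D}=(\mathbf{X}_{\mathcal{D},\Gamma_D},\Pi_{\mathcal{D}},\mathcal{T}_{\mathcal{D}},\nabla_{\mathcal{D}})$ is a Gradient Discretisation, then there is a unique $\mathbf{u}_{\mathcal{D}}\in\mathbf{X}_{\mathcal{D},\Gamma_D}$ such that, for all $\mathbf{v}\in\mathbf{X}_{\mathcal{D},\Gamma_D}$, $$\int_\Omega \mathbb{C}\,\boldsymbol\varepsilon_{\mathcal D}(\mathbf{u}_{\mathcal D}):\boldsymbol\varepsilon_{\mathcal D}(\mathbf{v})\,dx=\int_\Omega\mathbf{F}\cdot\Pi_{\mathcal D}\mathbf{v}\,dx+\int_{\Gamma_N}\mathbf{g}\cdot\mathcal{T}_{\mathcal D}(\mathbf{v})\,dS,$$ and it satisfies $$\|\nabla\overline{\mathbf{u}}-\nabla_{\mathcal D}\mathbf{u}_{\mathcal D}\|_{\mathbf{L}^2(\Omega)^d}\le\frac{K_{\mathcal D}^2}{\sigma_*}W_{\mathcal D}(\mathbb{C}\boldsymbol\varepsilon(\overline{\mathbf{u}}))+\left(\frac{K_{\mathcal D}^2\sigma^*}{\sigma_*}+1\right)S_{\mathcal D}(\overline{\mathbf{u}}),$$ $$\|\overline{\mathbf{u}}-\Pi_{\mathcal D}\mathbf{u}_{\mathcal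 D}\|_{\mathbf{L}^2(\Omega)}\le\frac{C_{\mathcal D}K_{\mathcal D}^2}{\sigma_*}W_{\mathcal D}(\mathbb{C}\boldsymbol\varepsilon(\overline{\mathbf{u}}))+\left(\frac{C_{\mathcal D}K_{\mathcal D}^2\sigma^*}{\sigma_*}+1\right)S_{\mathcal D}(\overline{\mathbf{u}}).$$
   Context: Notation: $\boldsymbol\tau:\boldsymbol\omega=\sum_{i,j}\boldsymbol\tau_{ij}\boldsymbol\omega_{ij}$ and $|\boldsymbol\tau|^2=\boldsymbol\tau:\boldsymbol\tau$ for $d\times d$ matrices; $|\mathbb{C}(x)|$ is the norm of $\mathbb{C}(x)$ as a linear map, so $|\mathbb{C}(x)\boldsymbol\tau|\le|\mathbb{C}(x)||\boldsymbol\tau|$. $\mathbf{L}^2(X)=L^2(X)^d$ (vector-valued), $\mathbf{L}^2(\Omega)^d=L^2(\Omega;\mathbb{R}^{d\times d})$ (tensor-valued), $\mathbf{H}^1(\Omega)=H^1(\Omega)^d$, $\gamma:\mathbf{H}^1(\Omega)\to\mathbf{L}^2(\partial\Omega)$ is the trace, $\mathbf{H}^1_{\Gamma_D}(\Omega)=\{\mathbf{v}\in\mathbf{H}^1(\Omega):\gamma(\mathbf{v})=0\text{ on }\Gamma_D\}$, $\nabla\mathbf{u}=(\partial_j u_i)_{i,j}$, $\boldsymbol\varepsilon(\mathbf{u})=\frac12(\nabla\mathbf{u}+(\nabla\mathbf{u})^T)$. The divergence of a tensor is taken row by row, $\operatorname{div}(\boldsymbol\tau)_i=\sum_j\partial_j\boldsymbol\tau_{ij}$.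 $\mathbf{H}_{\operatorname{div}}(\Omega,\Gamma_N)$ is the set of tensor fields $\boldsymbol\tau\in L^2(\Omega;\mathbb{R}^{d\times d})$ with $\operatorname{div}\boldsymbol\tau\in\mathbf{L}^2(\Omega)$ and normal trace $\gamma_{\mathbf n}(\boldsymbol\tau)\in\mathbf{L}^2(\Gamma_N)$; here $\gamma_{\mathbf n}(\boldsymbol\tau)\in\mathbf{H}^{-1/2}(\partial\Omega)$ is the usual normal trace, and the last condition means that its restriction to $\Gamma_N$ is an $\mathbf{L}^2$ function. A Gradient Discretisation is $\mathcal D=(\mathbf{X}_{\mathcal D,\Gamma_D},\Pi_{\mathcal D},\mathcal T_{\mathcal D},\nabla_{\mathcal D})$ where $\mathbf{X}_{\mathcal D,\Gamma_D}$ is a finite-dimensional real vector space (whose definition accounts for the null trace condition on $\Gamma_D$) and $\Pi_{\mathcal D}:\mathbf{X}_{\mathcal D,\Gamma_D}\to\mathbf{L}^2(\Omega)$, $\mathcal T_{\mathcal D}:\mathbf{X}_{\mathcal D,\Gamma_D}\to\mathbf{L}^2(\Gamma_N)$, $\nabla_{\mathcal D}:\mathbf{X}_{\mathcal D,\Gamma_D}\to\mathbf{L}^2(\Omega)^d$ are linear, with $\|\mathbf{v}\|_{\mathcal D}:=\|\nabla_{\mathcal D}\mathbf{v}\|_{\mathbf{L}^2(\Omega)^d}$ a norm on $\mathbf{X}_{\mathcal D,\Gamma_D}$. Set $\boldsymbol\varepsilon_{\mathcal D}(\mathbf{v})=\frac12(\nabla_{\mathcal D}\mathbf{v}+(\nabla_{\mathcal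 D}\mathbf{v})^T)$. Define $$S_{\mathcal D}(\boldsymbol\varphi)=\min_{\mathbf{v}\in\mathbf{X}_{\mathcal D,\Gamma_D}}\big\{\|\Pi_{\mathcal D}\mathbf{v}-\boldsymbol\varphi\|_{\mathbf{L}^2(\Omega)}+\|\nabla_{\mathcal D}\mathbf{v}-\nabla\boldsymbol\varphi\|_{\mathbf{L}^2(\Omega)^d}\big\}\quad(\boldsymbol\varphi\in\mathbf{H}^1_{\Gamma_D}(\Omega)),$$ $$W_{\mathcal D}(\boldsymbol\tau)=\max_{\mathbf{v}\ne0}\frac{1}{\|\mathbf{v}\|_{\mathcal D}}\left|\int_\Omega\big(\nabla_{\mathcal D}\mathbf{v}:\boldsymbol\tau+\Pi_{\mathcal D}\mathbf{v}\cdot\operatorname{div}(\boldsymbol\tau)\big)dx-\int_{\Gamma_N}\gamma_{\mathbf n}(\boldsymbol\tau)\cdot\mathcal T_{\mathcal D}(\mathbf{v})\,dS\right|\quad(\boldsymbol\tau\in\mathbf{H}_{\operatorname{div}}(\Omega,\Gamma_N)),$$ $$C_{\mathcal D}=\max_{\mathbf{v}\ne0}\max\left(\frac{\|\Pi_{\mathcal D}\mathbf{v}\|_{\mathbf{L}^2(\Omega)}}{\|\mathbf{v}\|_{\mathcal D}},\frac{\|\mathcal T_{\mathcal D}\mathbf{v}\|_{\mathbf{L}^2(\Gamma_N)}}{\|\mathbf{v}\|_{\mathcal D}}\right),\qquad K_{\mathcal D}=\max_{\mathbf{v}\ne0}\frac{\|\mathbf{v}\|_{\mathcal D}}{\|\boldsymbol\varepsilon_{\mathcal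 D}(\mathbf{v})\|_{\mathbf{L}^2(\Omega)^d}},$$ the maxima being over $\mathbf{v}\in\mathbf{X}_{\mathcal D,\Gamma_D}\setminus\{0\}$.
   Formalization: The formal theorem additionally assumes that K_D is finite; otherwise some nonzero v has ε_D(v)=0, so K_D is undefined and uniqueness of u_D fails. *)

(* Defs.v *)
From HB Require Import structures.
From mathcomp Require Import all_boot all_order all_algebra.
From mathcomp Require Import all_classical all_reals all_analysis.

Set Implicit Arguments.
Unset Strict Implicit.
Unset Printing Implicit Defensive.
Import Order.TTheory GRing.Theory Num.Theory.
Import numFieldNormedType.Exports.

Local Open Scope classical_set_scope.
Local Open Scope ring_scope.

(* Vectors of R^d are rows 'rV[R]_d and tensors are matrices 'M[R]_d, so that
   the pairing below is the scalar product of vectors as well as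
   [tau : omega]. The library norm `|A| is the sup norm; [fnorm] is the
   Euclidean one. *)
Definition frob (R : realType) (m n : nat) (A B : 'M[R]_(m, n)) : R :=
  \sum_i \sum_j A i j * B i j.

Definition fnorm (R : realType) (m n : nat) (A : 'M[R]_(m, n)) : R :=
  Num.sqrt (frob A A).

Definition sym (R : realType) (d : nat) (A : 'M[R]_d) : 'M[R]_d :=
  2%:R^-1 *: (A + A^T).

Section CoverOuterMeasure.
Local Open Scope ereal_scope.
Context {R : realType} {T : pointedType}.
Implicit Types (g : set T -> \bar R) (A : set T).

Definition gauge0 g A : \bar R := if A == set0 then 0 else g A.

Definition cover_outer g A : \bar R :=
  ereal_inf [set \sum_(k <oo) gauge0 g (F k) |
             F in [set F : nat -> set T | A `<=` \bigcup_k F k]].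

Lemma cover_outerE g :
  cover_outer g =
  @mu_ext _ (g_sigma_algebraType [set: set T]) R (gauge0 g).
Proof.
apply/funext => A; congr ereal_inf; apply/seteqP; split=> _ [F AF <-] /=.
  by exists F => //; split => // k; exact: sub_sigma_algebra.
by exists F => //; case: AF.
Qed.

Lemma gauge0_set0 g : gauge0 g set0 = 0.
Proof. by rewrite /gauge0 eqxx. Qed.

Lemma gauge0_ge0 g : (forall A, A !=set0 -> 0 <= g A) ->
  forall A, 0 <= gauge0 g A.
Proof.
move=> g0 A; rewrite /gauge0; case: ifPn => // /set0P; exact: g0.
Qed.

Variable g : set T -> \bar R.
Hypothesis g0 : forall A, A !=set0 -> 0 <= g A.

Lemma cover_outer0 : cover_outer g set0 = 0.
Proof.
by rewrite cover_outerE mu_ext0//; [exact: gauge0_set0|exact: gauge0_ge0].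
Qed.

Lemma cover_outer_ge0 A : 0 <= cover_outer g A.
Proof. by rewrite cover_outerE mu_ext_ge0//; exact: gauge0_ge0. Qed.

Lemma le_cover_outer :
  {homo cover_outer g : A B / A `<=` B >-> A <= B}.
Proof. by move=> A B AB; rewrite cover_outerE; exact: le_mu_ext. Qed.

Lemma cover_outer_sigma_subadditive : sigma_subadditive (cover_outer g).
Proof.
move=> F; rewrite cover_outerE.
exact: (@mu_ext_sigma_subadditive _ (g_sigma_algebraType [set: set T]) R _
  (gauge0_ge0 g0) F).
Qed.

End CoverOuterMeasure.

Definition caratheodory_measure (R : realType) (T : pointedType)
    (mu : {outer_measure set T -> \bar R}) :
    {measure set (caratheodory_type mu) -> \bar R} :=
  [the {measure set (caratheodory_type mu) -> \bar R} of
     (mu : set (caratheodory_type mu) -> \bar R)].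

(* The d-dimensional Lebesgue measure: outer measure of countable covers by
   boxes, restricted to its Caratheodory sigma-algebra. *)

Section Volume.
Local Open Scope ereal_scope.
Variables (R : realType) (d : nat).

Definition box (a b : 'rV[R]_d) : set 'rV[R]_d :=
  [set x | forall i, (a ord0 i <= x ord0 i <= b ord0 i)%R].

Definition box_gauge (A : set 'rV[R]_d) : \bar R :=
  ereal_inf [set r | exists a b : 'rV[R]_d,
    [/\ forall i, (a ord0 i <= b ord0 i)%R, A `<=` box a b &
        r = (\prod_i (b ord0 i - a ord0 i))%R%:E]].

Lemma box_gauge_ge0 A : 0 <= box_gauge A.
Proof.
apply: le_ereal_inf_tmp => _ [a [b [ab _ ->]]].
by rewrite lee_fin prodr_ge0// => i _; rewrite subr_ge0.
Qed.

Definition vol_outer : set 'rV[R]_d -> \bar R := cover_outer box_gauge.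

HB.instance Definition _ := isOuterMeasure.Build R 'rV[R]_d vol_outer
  (cover_outer0 (fun A _ => box_gauge_ge0 A))
  (cover_outer_ge0 (fun A _ => box_gauge_ge0 A))
  (@le_cover_outer _ _ box_gauge)
  (cover_outer_sigma_subadditive (fun A _ => box_gauge_ge0 A)).

Definition volT := caratheodory_type vol_outer.

Definition vol : {measure set volT -> \bar R} :=
  caratheodory_measure vol_outer.

End Volume.

(* The s-dimensional Hausdorff measure. The constant [ball_vol s / 2 ^ s], in
   which [ball_vol s] is the Lebesgue measure of the unit ball of R^s, makes
   it the usual surface measure on s-dimensional Lipschitz surfaces (and the
   counting measure when s = 0). *)

Fixpoint ball_vol (R : realType) (s : nat) : R :=
  match s with
  | 0 => 1
  | 1 => 2
  | s'.+2 => 2 * pi / s%:R * ball_vol R s'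
  end.

Section Hausdorff.
Local Open Scope ereal_scope.
Variables (R : realType) (d s : nat).

Definition diam (A : set 'rV[R]_d) : \bar R :=
  ereal_sup [set (fnorm (x - y))%:E | x in A & y in A].

Definition hausdorff_gauge (delta : R) (A : set 'rV[R]_d) : \bar R :=
  if diam A <= delta%:E then (ball_vol R s / 2 ^+ s)%:E * diam A ^+ s else +oo.

Definition hausdorff_outer (A : set 'rV[R]_d) : \bar R :=
  ereal_sup [set cover_outer (hausdorff_gauge delta) A |
             delta in [set delta : R | (0 < delta)%R]].

Lemma ball_vol_ge0 (k : nat) : (0 <= ball_vol R k)%R.
Proof.
suff: (0 <= ball_vol R k)%R /\ (0 <= ball_vol R k.+1)%R by case.
elim: k => [|k [IH1 IH2]]; first by split; rewrite /= ?ler01 ?ler0n.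
by split => //; rewrite [ball_vol _ _]/= !mulr_ge0// ?pi_ge0// invr_ge0.
Qed.

Lemma diam_ge0 A : A !=set0 -> 0 <= diam A.
Proof.
move=> [x Ax]; apply: (@le_trans _ _ (fnorm (x - x))%:E).
  by rewrite lee_fin sqrtr_ge0.
by apply: ereal_sup_ubound; exists x => //; exists x.
Qed.

Lemma hausdorff_gauge_ge0 delta A : A !=set0 -> 0 <= hausdorff_gauge delta A.
Proof.
move=> A0; rewrite /hausdorff_gauge; case: ifPn => // _.
rewrite mule_ge0 ?expe_ge0 ?diam_ge0//.
by rewrite lee_fin divr_ge0 ?ball_vol_ge0// exprn_ge0.
Qed.

Lemma hausdorff_outer_ge A delta : (0 < delta)%R ->
  cover_outer (hausdorff_gauge delta) A <= hausdorff_outer A.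
Proof. by move=> delta0; apply: ereal_sup_ubound; exists delta. Qed.

Lemma hausdorff_outer0 : hausdorff_outer set0 = 0.
Proof.
apply/eqP; rewrite eq_le; apply/andP; split.
  apply: ge_ereal_sup => _ [delta _ <-].
  by rewrite cover_outer0//; exact: hausdorff_gauge_ge0.
rewrite -(cover_outer0 (@hausdorff_gauge_ge0 1%R)).
exact: hausdorff_outer_ge.
Qed.

Lemma hausdorff_outer_ge0 A : 0 <= hausdorff_outer A.
Proof.
apply: le_trans (hausdorff_outer_ge A ltr01).
by apply: cover_outer_ge0; exact: hausdorff_gauge_ge0.
Qed.

Lemma le_hausdorff_outer :
  {homo hausdorff_outer : A B / A `<=` B >-> A <= B}.
Proof.
move=> A B AB; apply: ge_ereal_sup => _ [delta delta0 <-].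
exact: le_trans (le_cover_outer _ AB) (hausdorff_outer_ge B delta0).
Qed.

Lemma hausdorff_outer_sigma_subadditive : sigma_subadditive hausdorff_outer.
Proof.
move=> F; apply: ge_ereal_sup => _ [delta delta0 <-].
apply: le_trans (cover_outer_sigma_subadditive
  (@hausdorff_gauge_ge0 delta) F) _.
apply: lee_nneseries => k _ /=; last exact: hausdorff_outer_ge.
by move=> _; apply: cover_outer_ge0; exact: hausdorff_gauge_ge0.
Qed.

HB.instance Definition _ := isOuterMeasure.Build R 'rV[R]_d hausdorff_outer
  hausdorff_outer0 hausdorff_outer_ge0 le_hausdorff_outer
  hausdorff_outer_sigma_subadditive.

Definition hausdorffT := caratheodory_type hausdorff_outer.

Definition hausdorff : {measure set hausdorffT -> \bar R} :=
  caratheodory_measure hausdorff_outer.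

End Hausdorff.

(* A field of L^2 is a function, not a class modulo almost everywhere
   equality. *)

Section L2.
Context {disp : measure_display} {T : measurableType disp} {R : realType}.
Variables (mu : {measure set T -> \bar R}) (D : set T) (m n : nat).
Implicit Types f : T -> 'M[R]_(m, n).

Definition L2norm_sqr f : \bar R :=
  (\int[mu]_(x in D) (frob (f x) (f x))%:E)%E.

Definition L2 f : Prop :=
  (forall i j, measurable_fun D (fun x => f x i j)) /\ (L2norm_sqr f < +oo)%E.

Definition L2norm f : R := Num.sqrt (fine (L2norm_sqr f)).

End L2.

Section Domain.
Variables (R : realType) (d : nat).
Local Notation Rd := 'rV[R]_d.

Definition boundary (Omega : set Rd) : set Rd :=
  closure Omega `\` interior Omega.

(* Around each boundary point Omega is the strict subgraph, in the direction
   of a unit vector e, of a Lipschitz function h of the component orthogonal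
   to e. *)
Definition lipschitz_boundary (Omega : set Rd) : Prop :=
  forall x, boundary Omega x ->
  exists (e : Rd) (r L : R) (h : Rd -> R),
    [/\ fnorm e = 1, 0 < r,
        forall y z, `|h y - h z| <= L * fnorm (y - z) &
        forall y, fnorm (y - x) < r ->
          (Omega y <-> frob y e < h (y - frob y e *: e))].

Definition surfT := hausdorffT R d d.-1.
Definition surf : {measure set surfT -> \bar R} := hausdorff R d d.-1.

Definition partial (j : 'I_d) (phi : Rd -> R) : Rd -> R :=
  'D_(delta_mx ord0 j) phi.

Fixpoint Ck (k : nat) (phi : Rd -> R) : Prop :=
  continuous phi /\
  if k is k'.+1 then
    forall j, (forall x, derivable phi x (delta_mx ord0 j)) /\
              Ck k' (partial j phi)
  else True.

Definition test_function (U : set Rd) (phi : Rd -> R) : Prop :=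
  [/\ forall k, Ck k phi,
      compact (closure [set x | phi x != 0]) &
      closure [set x | phi x != 0] `<=` U].

Definition classical_grad (phi : Rd -> Rd) (x : Rd) : 'M[R]_d :=
  \matrix_(i, j) partial j (fun y => phi y ord0 i) x.

Definition weak_grad (Omega : set Rd) (u : Rd -> Rd) (Du : Rd -> 'M[R]_d) :=
  forall phi, test_function Omega phi -> forall i j,
    \int[vol R d]_(x in Omega) (u x ord0 i * partial j phi x) =
    - \int[vol R d]_(x in Omega) (Du x i j * phi x).

Record H1 (Omega : set Rd) := MkH1 {
  H1_fun :> Rd -> Rd;
  grad : Rd -> 'M[R]_d;
  H1_fun_L2 : L2 (vol R d) Omega H1_fun;
  grad_L2 : L2 (vol R d) Omega grad;
  H1_weak_grad : weak_grad Omega H1_fun grad }.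

Definition eps Omega (u : H1 Omega) (x : Rd) : 'M[R]_d := sym (grad u x).

(* [is_trace v t]: t = gamma(v). On a Lipschitz domain gamma is the continuous
   extension of the restriction to the boundary from the restrictions to Omega
   of smooth compactly supported functions, which are dense in H^1. *)
Definition is_trace Omega (v : H1 Omega) (t : Rd -> Rd) : Prop :=
  L2 surf (boundary Omega) t /\
  exists phi : nat -> Rd -> Rd,
    [/\ forall n i, test_function setT (fun x => phi n x ord0 i),
        L2norm_sqr (vol R d) Omega (fun x => phi n x - v x)
          @[n --> \oo] --> 0%E,
        L2norm_sqr (vol R d) Omega
            (fun x => classical_grad (phi n) x - grad v x)
          @[n --> \oo] --> 0%E &
        L2norm_sqr surf (boundary Omega) (fun x => phi n x - t x)
          @[n --> \oo] --> 0%E].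

Definition is_trace0 Omega (Gamma : set Rd) (v : H1 Omega) (t : Rd -> Rd) :=
  is_trace v t /\ {ae surf, forall x, Gamma x -> t x = 0}.

Definition H1_zero_on Omega (Gamma : set Rd) : set (H1 Omega) :=
  [set v | exists t, is_trace0 Gamma v t].

Definition is_div (Omega : set Rd) (tau : Rd -> 'M[R]_d) (G : Rd -> Rd) :=
  L2 (vol R d) Omega G /\
  forall phi, test_function Omega phi -> forall i,
    \int[vol R d]_(x in Omega) (\sum_j tau x i j * partial j phi x) =
    - \int[vol R d]_(x in Omega) (G x ord0 i * phi x).

(* [is_normal_trace GammaN tau G h], where G = div tau: the functional
   gamma_n(tau) : gamma(v) |-> \int_Omega (tau : grad v + div tau . v) of
   H^{-1/2}(boundary Omega) is represented on GammaN by the L^2 function h,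
   i.e. it is gamma(v) |-> \int_GammaN h . gamma(v) on the traces that vanish
   outside GammaN. *)
Definition is_normal_trace (Omega GammaN : set Rd) (tau : Rd -> 'M[R]_d)
    (G h : Rd -> Rd) : Prop :=
  L2 surf GammaN h /\
  forall (v : H1 Omega) t, is_trace0 (boundary Omega `\` GammaN) v t ->
    \int[vol R d]_(x in Omega) (frob (tau x) (grad v x) + frob (G x) (v x)) =
    \int[surf]_(x in GammaN) frob (h x) (t x).

Definition Hdiv (Omega GammaN : set Rd) : set (Rd -> 'M[R]_d) :=
  [set tau | L2 (vol R d) Omega tau /\
    exists G h, is_div Omega tau G /\ is_normal_trace Omega GammaN tau G h].

Definition tensor4 := 'I_d -> 'I_d -> 'I_d -> 'I_d -> R.

Definition tapp (C : tensor4) (tau : 'M[R]_d) : 'M[R]_d :=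
  \matrix_(i, j) \sum_k \sum_l C i j k l * tau k l.

Definition topnorm (C : tensor4) : \bar R :=
  ereal_sup [set (fnorm (tapp C tau))%:E | tau in [set tau | fnorm tau <= 1]].

Definition is_elasticity_tensor (Omega : set Rd) (C : Rd -> tensor4)
    (sigma_up sigma_lo : R) : Prop :=
  (forall i j k l,
     measurable_fun (Omega : set (volT R d)) (fun x => C x i j k l)) /\
  {ae vol R d, forall x, Omega x -> forall tau omega : 'M[R]_d,
    [/\ frob (tapp (C x) tau) omega = frob tau (tapp (C x) omega),
        (tapp (C x) tau)^T = tapp (C x) tau^T,
        (topnorm (C x) <= sigma_up%:E)%E &
        sigma_lo * fnorm tau ^+ 2 <= frob (tapp (C x) tau) tau]}.

Definition weak_solution (Omega GammaD GammaN : set Rd) (C : Rd -> tensor4)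
    (F g : Rd -> Rd) (u : H1 Omega) : Prop :=
  H1_zero_on GammaD u /\
  forall (v : H1 Omega) t, is_trace0 GammaD v t ->
    \int[vol R d]_(x in Omega) frob (tapp (C x) (eps u x)) (eps v x) =
    \int[vol R d]_(x in Omega) frob (F x) (v x) +
    \int[surf]_(x in GammaN) frob (g x) (t x).

(* Linearity is that of maps into L^2, hence almost everywhere. [gd_definite]
   makes the seminorm ||grad_D v|| a norm. *)
Record gradient_discretisation (Omega GammaN : set Rd) := GradDisc {
  gd_X : vectType R;
  gd_Pi : gd_X -> Rd -> Rd;
  gd_T : gd_X -> Rd -> Rd;
  gd_grad : gd_X -> Rd -> 'M[R]_d;
  gd_Pi_L2 : forall v, L2 (vol R d) Omega (gd_Pi v);
  gd_T_L2 : forall v, L2 surf GammaN (gd_T v);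
  gd_grad_L2 : forall v, L2 (vol R d) Omega (gd_grad v);
  gd_Pi_linear : forall (a : R) (v w : gd_X),
    {ae vol R d, forall x, Omega x ->
      gd_Pi (a *: v + w) x = a *: gd_Pi v x + gd_Pi w x};
  gd_T_linear : forall (a : R) (v w : gd_X),
    {ae surf, forall x, GammaN x ->
      gd_T (a *: v + w) x = a *: gd_T v x + gd_T w x};
  gd_grad_linear : forall (a : R) (v w : gd_X),
    {ae vol R d, forall x, Omega x ->
      gd_grad (a *: v + w) x = a *: gd_grad v x + gd_grad w x};
  gd_definite : forall v, L2norm (vol R d) Omega (gd_grad v) = 0 -> v = 0 }.

Section GradientDiscretisation.
Variables (Omega GammaN : set Rd) (D : gradient_discretisation Omega GammaN).

Definition gd_norm (v : gd_X D) : R := L2norm (vol R d) Omega (gd_grad v).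

Definition gd_eps (v : gd_X D) (x : Rd) : 'M[R]_d := sym (gd_grad v x).

Definition gd_S (phi : H1 Omega) : \bar R :=
  ereal_inf [set (L2norm (vol R d) Omega (fun x => gd_Pi v x - phi x) +
                  L2norm (vol R d) Omega
                    (fun x => gd_grad v x - grad phi x))%:E |
             v in [set: gd_X D]].

(* Maxima of nonnegative quantities over v != 0; adding 0 to the set only
   fixes the value 0 when X = {0}. *)
Definition gd_max (A : set (\bar R)) : \bar R := ereal_sup (0%E |` A).

(* G and h run over the representatives of div tau and of the normal trace
   of tau on GammaN. They are unique up to null sets, h at least when GammaN
   is relatively open in the boundary; for an arbitrary measurable GammaN the
   supremum keeps gd_W independent of the choice of h. *)
Definition gd_W (tau : Rd -> 'M[R]_d) : \bar R :=
  gd_max [set r | exists (v : gd_X D) (G h : Rd -> Rd),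
    [/\ v != 0, is_div Omega tau G, is_normal_trace Omega GammaN tau G h &
        r = (`|\int[vol R d]_(x in Omega)
                 (frob (gd_grad v x) (tau x) + frob (gd_Pi v x) (G x)) -
               \int[surf]_(x in GammaN) frob (h x) (gd_T v x)|
             / gd_norm v)%:E]].

Definition gd_C : \bar R :=
  gd_max [set (Num.max (L2norm (vol R d) Omega (gd_Pi v) / gd_norm v)
                     (L2norm surf GammaN (gd_T v) / gd_norm v))%:E |
        v in [set v : gd_X D | v != 0]].

(* Extended quotients: the value is +oo if eps_D(v) = 0 for some v != 0. *)
Definition gd_K : \bar R :=
  gd_max [set ((gd_norm v)%:E / (L2norm (vol R d) Omega (gd_eps v))%:E)%E |
        v in [set v : gd_X D | v != 0]].

Definition gradient_scheme (C : Rd -> tensor4) (F g : Rd -> Rd)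
    (u : gd_X D) : Prop :=
  forall v : gd_X D,
    \int[vol R d]_(x in Omega) frob (tapp (C x) (gd_eps u x)) (gd_eps v x) =
    \int[vol R d]_(x in Omega) frob (F x) (gd_Pi v x) +
    \int[surf]_(x in GammaN) frob (g x) (gd_T v x).

End GradientDiscretisation.
End Domain.

(* Main.v *)
(* Testing the weak formulation with the fields phi e_i, phi a test function of
   Omega, gives div sigma = - F for the stress sigma = C eps(u), and g
   represents the normal trace of sigma on GammaN. That phi e_i lies in H^1 with
   its classical gradient is integration by parts, which follows from the
   translation invariance of the Lebesgue measure.

   The discrete form a(v, w) = \int C eps_D(v) : eps_D(w) is coercive, because
   ||v|| <= K_D ||eps_D(v)||; on a finite-dimensional space this yields u_D.
   For any v put e = v - u_D. As div sigma = - F and the normal trace is g,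
     a(e, e) = \int C (eps_D(v) - eps(u)) : eps_D(e) + r(e),
   with r(e) <= W_D(sigma) ||e|| the quantity measured by W_D. Hence
     ||e|| <= K_D^2 / sigma_lo (W_D(sigma) + sigma_up ||grad_D v - grad u||),
   and both estimates follow from the triangle inequality by taking the infimum
   over v. As the infimum and W_D live in \bar R, the second one also needs
   C_D < +oo, which holds in finite dimension. *)
Require Import Defs.
From mathcomp Require Import all_boot all_order all_algebra.
From mathcomp Require Import all_classical all_reals all_analysis.
From mathcomp Require Import measurable_realfun ring lra.
Import Order.TTheory GRing.Theory Num.Theory.
Import numFieldNormedType.Exports.
Local Open Scope classical_set_scope.
Local Open Scope ring_scope.
Set Implicit Arguments.
Unset Strict Implicit.
Unset Printing Implicit Defensive.

(** * Inner products and norms in L^2 *)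

Section Frobenius.
Context {R : realType} {m n : nat}.
Implicit Types A B : 'M[R]_(m, n).

Lemma frobC A B : frob A B = frob B A.
Proof. by apply: eq_bigr => i _; apply: eq_bigr => j _; rewrite mulrC. Qed.

Lemma frobDl A A' B : frob (A + A') B = frob A B + frob A' B.
Proof.
rewrite /frob -big_split; apply: eq_bigr => i _.
by rewrite -big_split; apply: eq_bigr => j _; rewrite mxE mulrDl.
Qed.

Lemma frobZl (a : R) A B : frob (a *: A) B = a * frob A B.
Proof.
rewrite /frob mulr_sumr; apply: eq_bigr => i _; rewrite mulr_sumr.
by apply: eq_bigr => j _; rewrite mxE mulrA.
Qed.

Lemma frobNl A B : frob (- A) B = - frob A B.
Proof. by rewrite -scaleN1r frobZl mulN1r. Qed.

Lemma frobDr A B B' : frob A (B + B') = frob A B + frob A B'.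
Proof. by rewrite frobC frobDl !(frobC A). Qed.

Lemma frobZr (a : R) A B : frob A (a *: B) = a * frob A B.
Proof. by rewrite frobC frobZl (frobC A). Qed.

Lemma frobNr A B : frob A (- B) = - frob A B.
Proof. by rewrite frobC frobNl (frobC A). Qed.

Lemma frob0l B : frob 0 B = 0.
Proof. by rewrite -(scale0r 0) frobZl mul0r. Qed.

Lemma frob_ge0 A : 0 <= frob A A.
Proof.
by apply: sumr_ge0 => i _; apply: sumr_ge0 => j _; rewrite -expr2 sqr_ge0.
Qed.

Lemma frob_eq0 A : frob A A = 0 -> A = 0.
Proof.
move=> /eqP; rewrite psumr_eq0; last first.
  by move=> i _; apply: sumr_ge0 => j _; rewrite -expr2 sqr_ge0.
move=> /allP A0; apply/matrixP => i j; rewrite mxE.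
have := A0 i; rewrite mem_index_enum => /(_ isT) /=.
rewrite psumr_eq0; last by move=> k _; rewrite -expr2 sqr_ge0.
move=> /allP /(_ j); rewrite mem_index_enum => /(_ isT) /=.
by rewrite mulf_eq0 orbb => /eqP.
Qed.

Lemma frob_addsq A B :
  frob (A + B) (A + B) <= 2 * (frob A A + frob B B).
Proof.
have := frob_ge0 (A - B); rewrite !(frobDl, frobDr, frobNl, frobNr) (frobC B A).
lra.
Qed.

(** Expansion of |A + B|^2 and |A - B|^2. The constant is not sharp: the bound only serves as an
    integrable majorant for the pairing of two L^2 fields, before Cauchy-Schwarz is available. *)
Lemma frob_abs_le A B : `|frob A B| <= frob A A + frob B B.
Proof.
have := frob_ge0 (A - B); have := frob_ge0 (A + B).
have := frob_ge0 A; have := frob_ge0 B.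
rewrite !(frobDl, frobDr, frobNl, frobNr) (frobC B A) ler_norml.
move=> *; apply/andP; split; lra.
Qed.

Lemma fnorm_ge0 A : 0 <= fnorm A.
Proof. exact: sqrtr_ge0. Qed.

Lemma fnorm_sqr A : fnorm A ^+ 2 = frob A A.
Proof. by rewrite sqr_sqrtr// frob_ge0. Qed.

Lemma fnormZ (a : R) A : fnorm (a *: A) = `|a| * fnorm A.
Proof.
rewrite /fnorm frobZl frobZr mulrA -expr2 sqrtrM ?sqr_ge0//.
by rewrite sqrtr_sqr.
Qed.

Lemma fnorm_eq0 A : fnorm A = 0 -> A = 0.
Proof.
by move=> A0; apply: frob_eq0; rewrite -fnorm_sqr A0 expr0n.
Qed.

End Frobenius.

Lemma frob_trmx (R : realType) m n (A B : 'M[R]_(m, n)) :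
  frob A^T B^T = frob A B.
Proof.
rewrite /frob exchange_big; apply: eq_bigr => i _.
by apply: eq_bigr => j _; rewrite !mxE.
Qed.

(** * Symmetric part of a tensor *)

Section Symmetric.
Context {R : realType} {d : nat}.
Implicit Types A B : 'M[R]_d.

Lemma sym_tr A : (sym A)^T = sym A.
Proof. by rewrite /sym linearZ /= linearD /= trmxK addrC. Qed.

(** Transposing both factors gives A : B^T = A : B, so a symmetric A does not see the skew part of
    B. *)
Lemma frob_sym A B : A^T = A -> frob A (sym B) = frob A B.
Proof.
move=> As; rewrite /sym frobZr frobDr.
have -> : frob A B^T = frob A B by rewrite -[in LHS]As frob_trmx.
lra.
Qed.

(** The difference of the two sides is |A - A^T|^2 / 4. *)
Lemma frob_sym_le A : frob (sym A) (sym A) <= frob A A.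
Proof.
rewrite frob_sym ?sym_tr// /sym frobZl frobDl.
have := frob_ge0 (A - A^T).
rewrite !(frobDl, frobDr, frobNl, frobNr) frob_trmx (frobC A A^T).
lra.
Qed.

Lemma symD A B : sym (A + B) = sym A + sym B.
Proof. by apply/matrixP => i j; rewrite !mxE; ring. Qed.

Lemma symZ (a : R) A : sym (a *: A) = a *: sym A.
Proof. by apply/matrixP => i j; rewrite !mxE; ring. Qed.

Lemma symB A B : sym (A - B) = sym A - sym B.
Proof. by rewrite symD -scaleN1r symZ scaleN1r. Qed.

End Symmetric.

(** The discriminant of a nonnegative quadratic polynomial is nonpositive. For c > 0 the polynomial
    is evaluated at its minimiser -b / c; for c = 0 it is affine, which forces b = 0. *)
Lemma cs_of_quadratic (R : realType) (a b c : R) : 0 <= a -> 0 <= c ->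
  (forall t, 0 <= a + t * (2 * b) + t ^+ 2 * c) -> b ^+ 2 <= a * c.
Proof.
move=> a0 c0 q; have [c_eq0|c_gt0] : c = 0 \/ 0 < c.
  by move: c0; rewrite le_eqVlt => /orP[/eqP->|]; [left|right].
  have [->|b0] := eqVneq b 0; first by rewrite expr0n mulr_ge0.
  (* At this point the affine polynomial takes the value -1. *)
  have := q (- (a + 1) / (2 * b)); rewrite c_eq0 mulr0 addr0 divfK ?mulf_neq0//.
  lra.
have := q (- b / c).
have -> : a + - b / c * (2 * b) + (- b / c) ^+ 2 * c = a - b ^+ 2 / c.
  by field; rewrite gt_eqF.
by rewrite subr_ge0 ler_pdivrMr.
Qed.

Section L2Theory.
Context {disp : measure_display} {T : measurableType disp} {R : realType}.
Variables (mu : {measure set T -> \bar R}) (D : set T) (mD : measurable D).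

Lemma aeS (P Q : T -> Prop) : (forall x, P x -> Q x) ->
  {ae mu, forall x, P x} -> {ae mu, forall x, Q x}.
Proof. by move=> PQ; apply: filterS. Qed.

Lemma ae_eq_EFin (f g : T -> R) :
  {ae mu, forall x, D x -> f x = g x} -> ae_eq mu D (EFin \o f) (EFin \o g).
Proof. by apply: filterS => x fg Dx /=; rewrite fg. Qed.

Lemma ae_eq_Rintegral (f g : T -> R) :
  measurable_fun D f -> measurable_fun D g ->
  {ae mu, forall x, D x -> f x = g x} ->
  \int[mu]_(x in D) f x = \int[mu]_(x in D) g x.
Proof.
move=> mf mg fg; congr fine; apply: ae_eq_integral => //.
- exact/measurable_EFinP.
- exact/measurable_EFinP.
- exact: ae_eq_EFin.
Qed.

Section Dim.
Context {m n : nat}.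
Implicit Types f g h : T -> 'M[R]_(m, n).

Definition ip f g : R := \int[mu]_(x in D) frob (f x) (g x).

Definition mx_measurable f := forall i j, measurable_fun D (fun x => f x i j).

Lemma measurable_frob f g : mx_measurable f -> mx_measurable g ->
  measurable_fun D (fun x => frob (f x) (g x)).
Proof.
move=> mf mg; rewrite /frob; apply: measurable_sum => i.
by apply: measurable_sum => j; apply: measurable_funM.
Qed.

Lemma L2_integrable_sqr f : L2 mu D f ->
  mu.-integrable D (EFin \o (fun x => frob (f x) (f x))).
Proof.
move=> [mf foo]; apply/integrableP; split.
  exact/measurable_EFinP/measurable_frob.
rewrite /L2norm_sqr in foo; apply: le_lt_trans foo.
under eq_integral do rewrite /= ger0_norm ?frob_ge0//.
exact: lexx.
Qed.

Lemma L2_integrable f g : L2 mu D f -> L2 mu D g ->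
  mu.-integrable D (EFin \o (fun x => frob (f x) (g x))).
Proof.
move=> Lf Lg.
apply: (@le_integrable _ _ _ mu D mD _
   (EFin \o (fun x => frob (f x) (f x) + frob (g x) (g x)))).
- apply/measurable_EFinP/measurable_frob; [exact: Lf.1|exact: Lg.1].
- move=> x _; rewrite /= lee_fin (le_trans (frob_abs_le _ _))//.
  exact: ler_norm.
- rewrite (_ : _ \o _ = (EFin \o (fun x => frob (f x) (f x))) \+
     (EFin \o (fun x => frob (g x) (g x))))%E; last exact/funext.
  by apply: integrableD => //; exact: L2_integrable_sqr.
Qed.

(** Basic criterion for membership in L^2: sums, multiples, symmetric parts, stresses and test
    fields below all reduce to it. The bound is required almost everywhere only, as the tensor
    bounds are. *)
Lemma L2_le_sqr f (k : T -> R) : mx_measurable f ->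
  mu.-integrable D (EFin \o k) ->
  {ae mu, forall x, D x -> frob (f x) (f x) <= k x} -> L2 mu D f.
Proof.
move=> mf ik fk; split => //; rewrite /L2norm_sqr.
have /integrableP[mk koo] := ik.
apply: le_lt_trans koo; apply: ae_ge0_le_integral => //.
- by move=> x _; rewrite lee_fin frob_ge0.
- exact/measurable_EFinP/measurable_frob.
- exact: measurableT_comp.
- by apply: filterS fk => x fk Dx; rewrite /= lee_fin (le_trans (fk Dx))// ler_norm.
Qed.

Lemma L2_le f g (c : R) : mx_measurable f -> L2 mu D g ->
  {ae mu, forall x, D x -> frob (f x) (f x) <= c * frob (g x) (g x)} ->
  L2 mu D f.
Proof.
move=> mf Lg; apply: L2_le_sqr => //.
have -> : EFin \o (fun x => c * frob (g x) (g x)) =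
          (fun x => c%:E * (EFin \o (fun x => frob (g x) (g x))) x)%E.
  exact/funext.
by apply: integrableZl => //; exact: L2_integrable_sqr.
Qed.

Lemma L2D f g : L2 mu D f -> L2 mu D g -> L2 mu D (fun x => f x + g x).
Proof.
move=> Lf Lg; apply: (@L2_le_sqr _ (fun x => 2 * (frob (f x) (f x) + frob (g x) (g x)))).
- move=> i j; under eq_fun do rewrite mxE.
  by apply: measurable_funD; [exact: Lf.1|exact: Lg.1].
- have -> : EFin \o (fun x => 2 * (frob (f x) (f x) + frob (g x) (g x))) =
      (fun x => 2%:E * ((EFin \o (fun x => frob (f x) (f x))) \+
             (EFin \o (fun x => frob (g x) (g x)))) x)%E by exact/funext.
  by apply: integrableZl => //; apply: integrableD => //; exact: L2_integrable_sqr.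
- by apply: aeW => x _; exact: frob_addsq.
Qed.

Lemma L2Z (a : R) f : L2 mu D f -> L2 mu D (fun x => a *: f x).
Proof.
move=> Lf; apply: (L2_le (g := f) (c := a ^+ 2)) => //.
- move=> i j; under eq_fun do rewrite mxE.
  by apply: measurable_funM => //; exact: Lf.1.
- by apply: aeW => x _; rewrite frobZl frobZr mulrA expr2.
Qed.

Lemma L2N f : L2 mu D f -> L2 mu D (fun x => - f x).
Proof.
by move=> Lf; under eq_fun do rewrite -scaleN1r; exact: L2Z.
Qed.

Lemma L2B f g : L2 mu D f -> L2 mu D g -> L2 mu D (fun x => f x - g x).
Proof. by move=> Lf Lg; apply: L2D => //; exact: L2N. Qed.

Lemma ipC f g : ip f g = ip g f.
Proof. by apply: eq_Rintegral => x _; rewrite frobC. Qed.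

Lemma ipDl f g h : L2 mu D f -> L2 mu D g -> L2 mu D h ->
  ip (fun x => f x + g x) h = ip f h + ip g h.
Proof.
move=> Lf Lg Lh; rewrite /ip -RintegralD//; [|exact: L2_integrable..].
by apply: eq_Rintegral => x _; rewrite frobDl.
Qed.

Lemma ipZl a f g : L2 mu D f -> L2 mu D g ->
  ip (fun x => a *: f x) g = a * ip f g.
Proof.
move=> Lf Lg; rewrite /ip -RintegralZl//; last exact: L2_integrable.
by apply: eq_Rintegral => x _; rewrite frobZl.
Qed.

Lemma ipNl f g : L2 mu D f -> L2 mu D g -> ip (fun x => - f x) g = - ip f g.
Proof.
move=> Lf Lg; rewrite -mulN1r -ipZl//; congr ip.
by apply/funext => x; rewrite scaleN1r.
Qed.

Lemma ipBl f g h : L2 mu D f -> L2 mu D g -> L2 mu D h ->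
  ip (fun x => f x - g x) h = ip f h - ip g h.
Proof. by move=> Lf Lg Lh; rewrite ipDl// ?ipNl//; exact: L2N. Qed.

Lemma ipDr f g h : L2 mu D f -> L2 mu D g -> L2 mu D h ->
  ip h (fun x => f x + g x) = ip h f + ip h g.
Proof. by move=> Lf Lg Lh; rewrite ipC ipDl// !(ipC h). Qed.

Lemma ipZr a f g : L2 mu D f -> L2 mu D g ->
  ip g (fun x => a *: f x) = a * ip g f.
Proof. by move=> Lf Lg; rewrite ipC ipZl// (ipC g). Qed.

Lemma ip_ge0 f : 0 <= ip f f.
Proof. by apply: Rintegral_ge0 => x _; exact: frob_ge0. Qed.

Lemma L2norm_ge0 f : 0 <= L2norm mu D f.
Proof. exact: sqrtr_ge0. Qed.

Lemma L2norm_ip f : L2norm mu D f = Num.sqrt (ip f f).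
Proof. by []. Qed.

Lemma L2norm_sq f : L2norm mu D f ^+ 2 = ip f f.
Proof. by rewrite L2norm_ip sqr_sqrtr// ip_ge0. Qed.

(** Cauchy-Schwarz: the squared norm of f + t g is a nonnegative quadratic polynomial in t. *)
Lemma ip_le_norm f g : L2 mu D f -> L2 mu D g ->
  `|ip f g| <= L2norm mu D f * L2norm mu D g.
Proof.
move=> Lf Lg.
rewrite -ler_sqr ?nnegrE ?mulr_ge0 ?L2norm_ge0// real_normK ?num_real//.
rewrite exprMn !L2norm_sq; apply: cs_of_quadratic; rewrite ?ip_ge0// => t.
have := ip_ge0 (fun x => f x + t *: g x).
have Ltg := L2Z t Lg; have Lftg := L2D Lf Ltg.
rewrite ipDl// !ipDr// ipZl// ipZl// !ipZr// (ipC g f).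
congr (_ <= _); ring.
Qed.

Lemma L2norm_triangle f g : L2 mu D f -> L2 mu D g ->
  L2norm mu D (fun x => f x + g x) <= L2norm mu D f + L2norm mu D g.
Proof.
move=> Lf Lg.
rewrite -ler_sqr ?nnegrE ?addr_ge0 ?L2norm_ge0// sqrrD !L2norm_sq.
have Lfg := L2D Lf Lg.
rewrite ipDl// !ipDr// (ipC g f).
have := le_trans (ler_norm _) (ip_le_norm Lf Lg).
rewrite mulr2n; lra.
Qed.

Lemma L2normN f : L2norm mu D (fun x => - f x) = L2norm mu D f.
Proof.
rewrite !L2norm_ip; congr Num.sqrt; apply: eq_Rintegral => x _.
by rewrite frobNl frobNr opprK.
Qed.

Lemma L2norm_distC f g :
  L2norm mu D (fun x => f x - g x) = L2norm mu D (fun x => g x - f x).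
Proof.
by rewrite -L2normN; congr L2norm; apply/funext => x; rewrite opprB.
Qed.

Lemma L2norm_dist_triangle f g h :
  L2 mu D f -> L2 mu D g -> L2 mu D h ->
  L2norm mu D (fun x => f x - h x) <=
  L2norm mu D (fun x => f x - g x) + L2norm mu D (fun x => g x - h x).
Proof.
move=> Lf Lg Lh; rewrite (_ : (fun x => f x - h x) =
    fun x => (f x - g x) + (g x - h x)).
  exact: L2norm_triangle (L2B Lf Lg) (L2B Lg Lh).
by apply/funext => x; rewrite addrA subrK.
Qed.

(** Fields are functions rather than classes, and the operators of a gradient discretisation are
    linear only almost everywhere; this lemma lets their identities pass to inner products. *)
Lemma ae_eq_ip f f' g g' :
  mx_measurable f -> mx_measurable f' -> mx_measurable g -> mx_measurable g' ->
  {ae mu, forall x, D x -> f x = f' x} ->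
  {ae mu, forall x, D x -> g x = g' x} -> ip f g = ip f' g'.
Proof.
move=> mf mf' mg mg' ff' gg'; apply: ae_eq_Rintegral; try exact: measurable_frob.
by apply: filterS2 ff' gg' => x ff' gg' Dx; rewrite ff'// gg'.
Qed.

Lemma ae_eq_L2norm f f' : mx_measurable f -> mx_measurable f' ->
  {ae mu, forall x, D x -> f x = f' x} -> L2norm mu D f = L2norm mu D f'.
Proof. by move=> *; rewrite !L2norm_ip; congr Num.sqrt; exact: ae_eq_ip. Qed.

Lemma L2norm_le f g (c : R) : 0 <= c -> L2 mu D f -> L2 mu D g ->
  {ae mu, forall x, D x -> frob (f x) (f x) <= c ^+ 2 * frob (g x) (g x)} ->
  L2norm mu D f <= c * L2norm mu D g.
Proof.
move=> c0 Lf Lg fg.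
rewrite -(@ler_sqr _ (L2norm _ _ _)) ?nnegrE ?mulr_ge0 ?L2norm_ge0//.
rewrite exprMn !L2norm_sq.
rewrite /ip -RintegralZl//; last exact: L2_integrable.
have /integrableP[mfg fgoo] :
    mu.-integrable D (EFin \o (fun x => c ^+ 2 * frob (g x) (g x))).
  have -> : EFin \o (fun x => c ^+ 2 * frob (g x) (g x)) =
          (fun x => (c ^+ 2)%:E * (EFin \o (fun x => frob (g x) (g x))) x)%E.
    exact/funext.
  by apply: integrableZl => //; exact: L2_integrable_sqr.
have pos x : 0 <= c ^+ 2 * frob (g x) (g x) by rewrite mulr_ge0 ?sqr_ge0 ?frob_ge0.
have lefg : (\int[mu]_(x in D) (frob (f x) (f x))%:E <=
         \int[mu]_(x in D) (c ^+ 2 * frob (g x) (g x))%:E)%E.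
  apply: ae_ge0_le_integral => //.
  - by move=> x _; rewrite lee_fin frob_ge0.
  - by apply/measurable_EFinP/measurable_frob; exact: Lf.1.
  - by move=> x _; rewrite lee_fin.
(* [fine] is monotone only between finite values, so both integrals must be shown finite. *)
apply: fine_le => //.
- rewrite ge0_fin_numE; first exact: Lf.2.
  by apply: integral_ge0 => x _; rewrite lee_fin frob_ge0.
- rewrite ge0_fin_numE; last by apply: integral_ge0 => x _; rewrite lee_fin.
  apply: le_lt_trans fgoo; apply: ge0_le_integral => //.
  + by move=> x _; rewrite lee_fin.
  + exact: measurableT_comp.
  + by move=> x _; rewrite /= lee_fin ler_norm.
Qed.

End Dim.
End L2Theory.

(** * Lebesgue measure on R^d *)

Section BoxCovers.
Context {R : realType} {d : nat}.
Implicit Types A X : set 'rV[R]_d.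

Definition halfspace (i : 'I_d) (c : R) : set 'rV[R]_d :=
  [set x | x ord0 i <= c].

Lemma gauge0_box A (a b : 'rV[R]_d) : (forall i, a ord0 i <= b ord0 i) ->
  A `<=` box a b ->
  (gauge0 (@box_gauge R d) A <= (\prod_i (b ord0 i - a ord0 i))%:E)%E.
Proof.
move=> ab Aab; rewrite /gauge0; case: ifPn => _.
  by rewrite lee_fin prodr_ge0// => i _; rewrite subr_ge0.
by apply: ereal_inf_lbound; exists a, b; split.
Qed.

(** The hyperplane x_i = c cuts an enclosing box of A into two boxes whose volumes add up to that of
    the box. If it misses the box, one of the two pieces of A is empty. *)
Lemma gauge0_halfspace_split A i c :
  (gauge0 (@box_gauge R d) (A `&` halfspace i c) +
   gauge0 (@box_gauge R d) (A `&` ~` halfspace i c) <=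
   gauge0 (@box_gauge R d) A)%E.
Proof.
have [->|A0] := eqVneq A set0; first by rewrite !set0I gauge0_set0 adde0.
rewrite [leRHS]/gauge0 (negbTE A0); apply: le_ereal_inf_tmp => _ [a [b [ab Aab ->]]].
have [ci|aci] := ltP c (a ord0 i).
  rewrite (_ : A `&` halfspace i c = set0); last first.
    apply/seteqP; split => // x [/Aab /(_ i) /andP[+ _]] /=.
    by rewrite /halfspace/= => /(lt_le_trans ci) /lt_geF ->.
  by rewrite gauge0_set0 add0e; apply: gauge0_box => // x [/Aab].
have [bi|cbi] := ltP (b ord0 i) c.
  rewrite (_ : A `&` ~` halfspace i c = set0); last first.
    apply/seteqP; split => // x [/Aab /(_ i) /andP[_ +]] /=.
    by rewrite /halfspace/= => /le_trans /(_ (ltW bi)).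
  by rewrite gauge0_set0 adde0; apply: gauge0_box => // x [/Aab].
pose b' : 'rV[R]_d := \row_j if j == i then c else b ord0 j.
pose a' : 'rV[R]_d := \row_j if j == i then c else a ord0 j.
apply: (@le_trans _ _ ((\prod_j (b' ord0 j - a ord0 j))%:E +
                       (\prod_j (b ord0 j - a' ord0 j))%:E)).
  apply: leeD; apply: gauge0_box.
  - by move=> j; rewrite mxE; case: eqP => [->|].
  - move=> x [/Aab xab xc] j; rewrite mxE; case: eqP => [->|//].
    by have /andP[-> _] := xab i.
  - by move=> j; rewrite mxE; case: eqP => [->|].
  - move=> x [/Aab xab /negP xc] j; rewrite mxE; case: eqP => [->|//].
    by have /andP[_ ->] := xab i; rewrite andbT ltW// ltNge.
(* The two boxes differ from the original one in the side i only, and these two sides, c - a_i and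
   b_i - c, sum to b_i - a_i. *)
rewrite -EFinD lee_fin (bigD1 i)//= [X in _ + X](bigD1 i)//= [leRHS](bigD1 i)//=.
rewrite !mxE eqxx.
under eq_bigr => j ji do rewrite mxE (negbTE ji).
under [X in _ + _ * X]eq_bigr => j ji do rewrite mxE (negbTE ji).
by rewrite -mulrDl addrC addrA subrK.
Qed.

(** Caratheodory's criterion: intersecting each member of a cover with the half-space and with its
    complement gives covers of the two pieces, and the previous lemma is summed over the members. *)
Lemma measurable_halfspace i c :
  measurable (halfspace i c : set (volT R d)).
Proof.
apply: le_caratheodory_measurable => X /=.
rewrite [leRHS]/vol_outer; apply: le_ereal_inf_tmp => _ [F XF <-].
have g0 (A : set 'rV[R]_d) : (0 <= gauge0 (@box_gauge R d) A)%E.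
  by apply: gauge0_ge0 => B _; exact: box_gauge_ge0.
apply: (@le_trans _ _
  (\sum_(k <oo) gauge0 (@box_gauge R d) (F k `&` halfspace i c) +
   \sum_(k <oo) gauge0 (@box_gauge R d) (F k `&` ~` halfspace i c))%E).
  apply: leeD; apply: ereal_inf_lbound.
  - by exists (fun k => F k `&` halfspace i c) => // x [/XF[k _ Fx] Hx]; exists k.
  - by exists (fun k => F k `&` ~` halfspace i c) => // x [/XF[k _ Fx] Hx]; exists k.
rewrite -nneseriesD//; apply: lee_nneseries => k _ //=.
- by move=> _; exact: adde_ge0.
- exact: gauge0_halfspace_split.
Qed.

Lemma measurable_cell (a b : 'rV[R]_d) :
  measurable ([set x | forall i, a ord0 i < x ord0 i <= b ord0 i] :
              set (volT R d)).
Proof.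
rewrite [X in measurable X](_ : _ = \bigcap_(i in [set: 'I_d])
    (halfspace i (b ord0 i) `&` ~` halfspace i (a ord0 i))).
  apply: fin_bigcap_measurable => // i _; apply: measurableI.
    exact: measurable_halfspace.
  by apply: measurableC; exact: measurable_halfspace.
apply/seteqP; split => x /= H.
  move=> i _; have /andP[ai bi] := H i; split => //.
  by apply/negP; rewrite -ltNge.
by move=> i; have [bi /negP] := H i I; rewrite -ltNge => ->.
Qed.

(** An open set is the union of the cells with rational corners that it contains. The union runs
    over all the countably many pairs of corners, a cell not contained in A being replaced by the
    empty set. *)
Lemma open_vol_measurable (A : set 'rV[R]_d) : open A ->
  measurable (A : set (volT R d)).
Proof.
move=> oA.
pose cell (p : 'rV[rat]_d * 'rV[rat]_d) : set 'rV[R]_d :=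
  [set x | forall i, ratr (p.1 ord0 i) < x ord0 i <= ratr (p.2 ord0 i)].
have -> : A = \bigcup_p (if `[< cell p `<=` A >] then cell p else set0).
  apply/seteqP; split => [x Ax|x [p _]]; last first.
    by case: asboolP => // pA; exact: pA.
  have /nbhs_ballP[e /= e0 xeA] : nbhs x A by exact: open_nbhs_nbhs.
  have lo i : x ord0 i - e < x ord0 i by rewrite gtrBl.
  have up i : x ord0 i < x ord0 i + e by rewrite ltrDl.
  pose a : 'rV[rat]_d := \row_i xchoose (rat_in_itvoo (lo i)).
  pose b : 'rV[rat]_d := \row_i xchoose (rat_in_itvoo (up i)).
  have aP i : x ord0 i - e < ratr (a ord0 i) < x ord0 i.
    by rewrite mxE; have := xchooseP (rat_in_itvoo (lo i)); rewrite in_itv.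
  have bP i : x ord0 i < ratr (b ord0 i) < x ord0 i + e.
    by rewrite mxE; have := xchooseP (rat_in_itvoo (up i)); rewrite in_itv.
  exists (a, b) => //; case: asboolP => [_ i /=|[] y xy].
    by have /andP[_ ->] := aP i; have /andP[/ltW -> _] := bP i.
  (* Balls are those of the sup norm, so it suffices that each side of the cell lies within e of the
     coordinate of x. *)
  apply: xeA; split => // i j; rewrite ord1 /ball /= ltr_norml.
  have /andP[a1 a2] := aP j; have /andP[b1 b2] := bP j.
  have /andP[y1 y2] := xy j; rewrite /= in y1 y2.
  by apply/andP; split; lra.
apply: countable_bigcupT_measurable; first exact: countableP.
move=> p; case: asboolP => // _.
have := measurable_cell (\row_i ratr (p.1 ord0 i)) (\row_i ratr (p.2 ord0 i)).
congr measurable; apply/funext => x; apply/propext.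
by split => H i; have := H i; rewrite !mxE.
Qed.

Lemma continuous_vol_measurable (f : 'rV[R]_d -> R) (D : set (volT R d)) :
  continuous f -> measurable_fun D f.
Proof.
move=> /continuousP cf; apply: (@measurable_funS _ _ _ _ setT) => //.
apply: (measurability _ (RGenOpens.measurableE R)).
move=> _ [_ [a [b ->] <-]]; rewrite setTI.
exact/open_vol_measurable/cf/interval_open.
Qed.

(** The box followed by empty sets is a cover, so the volume is at most the product of the sides.
    This makes bounded functions supported in a box integrable. *)
Lemma vol_box_lty (a b : 'rV[R]_d) : (vol R d (box a b) < +oo)%E.
Proof.
have [/existsP[i bai]|] := boolP [exists i, b ord0 i < a ord0 i].
  have -> : box a b = set0.
    apply/seteqP; split => // x /(_ i) /andP[ax xb].
    by have := lt_le_trans bai (le_trans ax xb); rewrite ltxx.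
  by rewrite measure0.
rewrite negb_exists => /forallP ab.
apply: (@le_lt_trans _ _ (\prod_i (b ord0 i - a ord0 i))%:E); last by rewrite ltry.
rewrite -[leRHS]adde0.
apply: ereal_inf_le.
pose F (k : nat) : set 'rV[R]_d := if k is 0%N then box a b else set0.
exists (\sum_(k <oo) gauge0 (@box_gauge R d) (F k))%E.
  by exists F => // x xab; exists 0%N.
rewrite (@nneseriesD1 _ _ 0%N) //; last first.
  by move=> k _; apply: gauge0_ge0 => B _; exact: box_gauge_ge0.
apply: leeD.
  by apply: gauge0_box => // i; rewrite leNgt ab.
rewrite eseries0// => -[|k] //= _ _; exact: gauge0_set0.
Qed.

(** Translating the members of a cover together with their enclosing boxes keeps the side lengths.
    The reverse inequality is the same statement for the opposite translation. *)
Lemma vol_outer_shift_le (A : set 'rV[R]_d) (e : 'rV[R]_d) :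
  (vol_outer [set x | A (x + e)%R] <= vol_outer A)%E.
Proof.
apply: le_ereal_inf_tmp => _ [F AF <-].
apply: ereal_inf_le.
exists (\sum_(k <oo) gauge0 (@box_gauge R d) [set x | F k (x + e)%R])%E.
  by exists (fun k => [set x | F k (x + e)]) => // x /AF[k _ Fx]; exists k.
apply: lee_nneseries => k _ //=.
  by move=> _; apply: gauge0_ge0 => B _; exact: box_gauge_ge0.
have [->|F0] := eqVneq (F k) set0.
  by rewrite (_ : [set x | _] = set0)// gauge0_set0.
rewrite [leRHS]/gauge0 (negbTE F0); apply: le_ereal_inf_tmp => _ [a [b [ab Fab ->]]].
rewrite (_ : \prod_i _ = \prod_i ((b - e) ord0 i - (a - e) ord0 i)); last first.
  by apply: eq_bigr => i _; rewrite !mxE; ring.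
apply: gauge0_box => [i|x /= /Fab + i]; first by rewrite !mxE lerD2r.
by move=> /(_ i); rewrite !mxE lerBlDr lerBrDr.
Qed.

Lemma vol_outer_shift (A : set 'rV[R]_d) (e : 'rV[R]_d) :
  vol_outer [set x | A (x + e)] = vol_outer A.
Proof.
apply/eqP; rewrite eq_le vol_outer_shift_le/=.
have := vol_outer_shift_le [set x | A (x + e)] (- e).
by congr (vol_outer _ <= _)%E; apply/funext => x /=; rewrite subrK.
Qed.

(** Continuity alone would give this for Borel sets only, whereas [volT] carries the whole
    Caratheodory sigma-algebra. The criterion for A is tested on the translate Y of X and carried
    back by translation invariance. *)
Lemma measurable_shift (e : 'rV[R]_d) :
  measurable_fun [set: volT R d] (fun x : volT R d => (x + e : volT R d)).
Proof.
move=> _ A mA; rewrite setTI; apply: le_caratheodory_measurable => X /=.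
pose Y := [set x | X (x - e)%R].
have E : vol_outer Y = (vol_outer (Y `&` A) + vol_outer (Y `&` ~` A))%E := mA Y.
rewrite -(vol_outer_shift X (- e)) E.
rewrite -(vol_outer_shift (Y `&` A) e) -(vol_outer_shift (Y `&` ~` A) e).
apply: leeD; apply: le_outer_measure => x /= [Xx Ax].
  by split => //; rewrite /Y/= addrK.
by split => //; rewrite /Y/= addrK.
Qed.

Lemma Rintegral_shift (f : 'rV[R]_d -> R) (e : 'rV[R]_d) : continuous f ->
  (vol R d).-integrable setT (EFin \o (fun x => f (x + e))) ->
  \int[vol R d]_x f (x + e) = \int[vol R d]_x f x.
Proof.
move=> cf intf; congr fine.
have := @integral_pushforward _ _ (volT R d) (volT R d) R _ (measurable_shift e)
  (vol R d) setT (EFin \o f).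
rewrite preimage_setT => <- //; last first.
  by apply/measurable_EFinP; exact: continuous_vol_measurable.
apply: eq_measure_integral; first exact: measurable_shift.
by move=> mshift A mA _; exact: (vol_outer_shift A e).
Qed.

End BoxCovers.

(** * Test functions and integration by parts *)

Section TestFunctions.
Context {R : realType} {d : nat}.
Local Notation Rd := 'rV[R]_d.
Implicit Types (f g phi psi : Rd -> R) (K : set Rd).

Lemma continuous_shift (e : Rd) : continuous (fun x : Rd => x + e).
Proof.
by move=> x; have cD := cvgD (@cvg_id _ (nbhs x)) (cvg_cst e); exact: cD.
Qed.

(** The difference quotients are the same. This turns a partial derivative into the derivative in a
    real parameter, the form needed to differentiate under the integral sign. *)
Lemma is_derive_line f (x e : Rd) (t : R) : derivable f (x + t *: e) e ->
  is_derive t 1 (fun s : R => f (x + s *: e)) ('D_e f (x + t *: e)).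
Proof.
move=> df.
have E : (fun h : R => h^-1 *: (((fun s : R => f (x + s *: e)) \o shift t) (h *: 1) -
            f (x + t *: e))) =
  (fun h : R => h^-1 *: ((f \o shift (x + t *: e)) (h *: e) - f (x + t *: e))).
  apply/funext => h /=; congr (_ *: (f _ - _)).
  by rewrite [_%:A]mulr1 scalerDl addrCA.
by apply: DeriveDef; rewrite /derivable /derive E.
Qed.

Lemma compact_support_bounds f K : continuous f -> compact K ->
  (forall x, f x != 0 -> K x) ->
  exists M N : R, [/\ 0 <= M, 0 <= N, forall x, `|f x| <= M &
    forall x, K x -> forall i, `|x ord0 i| <= N].
Proof.
move=> cf cK fK.
have [M [_ MP]] : bounded_set (f @` K).
  by apply/compact_bounded/continuous_compact => //; exact: continuous_subspaceT.
have [N [_ NP]] := compact_bounded cK.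
exists (`|M| + 1), (`|N| + 1); split; rewrite ?addr_ge0//.
- move=> x; have [->|/fK Kx] := eqVneq (f x) 0; first by rewrite normr0 addr_ge0.
  by apply: MP; [rewrite (le_lt_trans (ler_norm _))// ltrDl|exists x].
- move=> x Kx i; apply: (@le_trans _ _ `|x|).
    rewrite [leRHS]/Num.norm /= mx_normrE; apply/bigmax_geP; right => /=.
    by exists (ord0, i).
  by apply: NP => //; rewrite (le_lt_trans (ler_norm _))// ltrDl.
Qed.

Lemma measurable_box (a b : Rd) : measurable (box a b : set (volT R d)).
Proof.
rewrite [X in measurable X](_ : _ = \bigcap_(i in [set: 'I_d])
   ((fun x : volT R d => (x : Rd) ord0 i) @^-1` `[a ord0 i, b ord0 i])).
  apply: fin_bigcap_measurable => // i _; rewrite -[X in measurable X]setTI.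
  apply: continuous_vol_measurable => //.
  by move=> x; exact: coord_continuous.
apply/seteqP; split => x /= H i; first by rewrite /= in_itv => _; exact: H.
by have := H i I; rewrite /= in_itv.
Qed.

Lemma box_dominated_integrable f (D : set (volT R d)) (M : R) (a b : Rd) :
  measurable D -> measurable_fun D f ->
  (forall x, `|f x| <= M * \1_(box a b) x) ->
  (vol R d).-integrable D (EFin \o f).
Proof.
move=> mD mf fM.
have mbox := measurable_box a b.
apply: (@le_integrable _ _ _ (vol R d) D mD _
  (EFin \o (fun x => M * \1_(box a b) x))).
- exact/measurable_EFinP.
- by move=> x _; rewrite /= lee_fin (le_trans (fM x))// ler_norm.
- have -> : EFin \o (fun x => M * \1_(box a b) x) =
      (fun x : volT R d => M%:E * (\1_(box a b : set (volT R d)) x)%:E)%E.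
    exact/funext.
  apply: integrableZl => //; apply: (@integrableS _ _ _ _ setT) => //.
  apply/integrableP; split; first exact/measurable_EFinP.
  under eq_integral do rewrite /= ger0_norm//.
  by rewrite integral_indic// setIT; exact: vol_box_lty.
Qed.

Lemma compact_support_integrable f K (D : set (volT R d)) :
  continuous f -> compact K ->
  (forall x, f x != 0 -> K x) -> measurable D ->
  (vol R d).-integrable D (EFin \o f).
Proof.
move=> cf cK fK mD.
have [M [N [M0 N0 fM KN]]] := compact_support_bounds cf cK fK.
apply: (@box_dominated_integrable _ _ M (const_mx (- N)) (const_mx N)) => //.
  exact: continuous_vol_measurable.
move=> x; have [fx0|/fK Kx] := eqVneq (f x) 0.
  by rewrite fx0 normr0 mulr_ge0// indicE.
rewrite indicE mem_set ?mulr1// => i; rewrite !mxE.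
by have := KN x Kx i; rewrite ler_norml.
Qed.

(** Off the closed support f vanishes in a neighbourhood of x, hence so does its derivative at x. *)
Lemma partial_support j f x : partial j f x != 0 ->
  closure [set x | f x != 0] x.
Proof.
apply: contraNP => xnK; apply/eqP; rewrite /partial.
rewrite (@near_eq_derive _ _ _ _ (cst 0)) ?derive_cst//.
have : nbhs x (~` closure [set x | f x != 0]).
  by apply: open_nbhs_nbhs; split => //; rewrite openC; exact: closed_closure.
apply: filterS => y ynK; apply/eqP; apply: contra_notT ynK => fy.
exact: subset_closure.
Qed.

(* By translation invariance t |-> \int f (x + t e_j) is constant; its
   derivative at 0 is the integral of partial j f. *)
Lemma Rintegral_partial_eq0 j f : Ck 1 f ->
  compact (closure [set x | f x != 0]) -> \int[vol R d]_x partial j f x = 0.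
Proof.
move=> [cf /(_ j) [df [cdf _]]] cK.
set K := closure _ in cK; set e : Rd := delta_mx ord0 j in df.
have fK x : f x != 0 -> K x by move=> fx; exact: subset_closure.
have dfK x : partial j f x != 0 -> K x by exact: partial_support.
have [M [N [M0 N0 dfM KN]]] := compact_support_bounds cdf cK dfK.
pose F (t : R) (x : volT R d) : R := f (x + t *: e).
have cF t : continuous (F t).
  move=> x; apply: (@continuous_comp _ _ _ (fun x : Rd => x + t *: e) f); last exact: cf.
  exact: continuous_shift.
have dF (t : R) (x : Rd) :
    is_derive t (1 : R) (fun s : R => F s x) (partial j f (x + t *: e)).
  exact: is_derive_line.
have intF t : (vol R d).-integrable setT (EFin \o F t).
  have cKt : compact [set x | K (x + t *: e)].
    have -> : [set x | K (x + t *: e)] = (fun x => x - t *: e) @` K.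
      apply/seteqP; split => [x Kx|_ [x Kx <-]] /=; last by rewrite subrK.
      by exists (x + t *: e); rewrite ?addrK.
    apply: continuous_compact => //; apply: continuous_subspaceT => x.
    exact: continuous_shift.
  by apply: (compact_support_integrable (cF t) cKt) => // x; exact: fK.
(* For |t| < 1 a point x with x + t e_j in K has coordinates of modulus at most N + 1, so G
   dominates the derivatives in t uniformly on this interval. *)
pose B : set (volT R d) := box (const_mx (- (N + 1))) (const_mx (N + 1)).
pose G (x : volT R d) : R := M * \1_B x.
have := @differentiation_under_integral R _ (volT R d) (vol R d) F setT measurableT
  0 (-1) 1.
have -> : (fun t => \int[vol R d]_x F t x) = cst (\int[vol R d]_x f x).
  by apply/funext => t; apply: Rintegral_shift => //; exact: intF.
have d1E t x : partial1of2 F t x = partial j f (x + t *: e).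
  by rewrite /partial1of2 derive1E; have [_ <-] := dF t x.
rewrite derive1_cst => /(_ _ _ _ G) DUI.
have -> : \int[vol R d]_x partial j f x = \int[vol R d]_x partial1of2 F 0 x.
  by apply: eq_Rintegral => x _; rewrite d1E scale0r addr0.
have G0 x : 0 <= G x by rewrite mulr_ge0// indicE.
apply: esym; apply: DUI => //.
- by rewrite /= in_itv/= ltrN10 ltr01.
- apply: (@box_dominated_integrable _ _ M
      (const_mx (- (N + 1))) (const_mx (N + 1))) => //.
    apply: measurable_funM => //; apply: measurable_indic.
    exact: measurable_box.
  by move=> x; rewrite ger0_norm.
- move=> t x; rewrite /= in_itv/= => /andP[t1 t2] _; rewrite d1E.
  have [->|/dfK Kxt] := eqVneq (partial j f (x + t *: e)) 0.
    by rewrite normr0.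
  rewrite /G indicE mem_set ?mulr1// => i; rewrite !mxE.
  have := KN _ Kxt i; rewrite !mxE eqxx /= ler_norml => /andP[].
  by case: (i == j); rewrite ?mulr1 ?mulr0 => n1 n2; apply/andP; split; lra.
Qed.

Lemma partialM j phi psi x : Ck 1 phi -> Ck 1 psi ->
  partial j (fun y => phi y * psi y) x =
  phi x * partial j psi x + psi x * partial j phi x.
Proof.
move=> [_ /(_ j) [dphi _]] [_ /(_ j) [dpsi _]].
exact: (deriveM (dphi x) (dpsi x)).
Qed.

Lemma continuous_mul phi psi : continuous phi -> continuous psi ->
  continuous (fun x => phi x * psi x).
Proof. by move=> cphi cpsi x; exact: (continuousM (cphi x) (cpsi x)). Qed.

Lemma Ck1M phi psi : Ck 1 phi -> Ck 1 psi -> Ck 1 (fun x => phi x * psi x).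
Proof.
move=> Cphi Cpsi; have [cphi dphi] := Cphi; have [cpsi dpsi] := Cpsi.
split; first exact: continuous_mul.
move=> j; have [dphij [cdphij _]] := dphi j; have [dpsij [cdpsij _]] := dpsi j.
split; first by move=> x; exact: (derivableM (dphij x) (dpsij x)).
split; last by [].
rewrite (_ : partial _ _ =
    fun x => phi x * partial j psi x + psi x * partial j phi x).
  move=> x; have cl := @continuous_mul _ _ cphi cdpsij x.
  by have clr := cvgD cl (@continuous_mul _ _ cpsi cdphij x); exact: clr.
by apply/funext => x; rewrite partialM.
Qed.

(** The derivative of the product has zero integral, since the product inherits the compact support
    of phi. *)
Lemma Rintegral_by_parts j phi psi : Ck 1 phi -> Ck 1 psi ->
  compact (closure [set x | phi x != 0]) ->
  \int[vol R d]_x (phi x * partial j psi x) =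
  - \int[vol R d]_x (partial j phi x * psi x).
Proof.
move=> Cphi Cpsi cK.
have [cphi /(_ j) [_ [cdphi _]]] := Cphi; have [cpsi /(_ j) [_ [cdpsi _]]] := Cpsi.
have suppM f g : (forall x, f x != 0 -> closure [set x | phi x != 0] x) ->
    forall x, f x * g x != 0 -> closure [set x | phi x != 0] x.
  by move=> H x; rewrite mulf_eq0 negb_or => /andP[/H].
have phiK x : phi x != 0 -> closure [set x | phi x != 0] x.
  by move=> ?; exact: subset_closure.
have := @Rintegral_partial_eq0 j (fun x => phi x * psi x) (Ck1M Cphi Cpsi).
have cK' : compact (closure [set x | phi x * psi x != 0]).
  apply: subclosed_compact cK _; first exact: closed_closure.
  by apply: closureS => x /=; rewrite mulf_eq0 negb_or => /andP[].
move=> /(_ cK'); under eq_Rintegral do rewrite partialM// [psi _ * _]mulrC.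
rewrite RintegralD//; first by move=> /eqP; rewrite addr_eq0 => /eqP.
- apply: compact_support_integrable cK _ _ => //; first exact: continuous_mul.
  exact: suppM.
- apply: compact_support_integrable cK _ _ => //; first exact: continuous_mul.
  by apply: suppM => x /partial_support.
Qed.

(** Moves the integrals over Omega to the whole space, where translations act and integration by
    parts is proved. *)
Lemma Rintegral_supported (Omega : set (volT R d)) f :
  (forall x, f x != 0 -> Omega x) ->
  \int[vol R d]_(x in Omega) f x = \int[vol R d]_x f x.
Proof.
move=> fO; rewrite Rintegral_mkcond; apply: eq_Rintegral => x _.
rewrite patchE; case: ifPn => // xO; apply/esym/eqP.
by apply: contraNT xO => /fO /mem_set.
Qed.

Lemma test_function_supp (Omega : set Rd) phi x :
  test_function Omega phi -> phi x != 0 -> Omega x.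
Proof. by move=> [_ _ sO] phix; apply: sO; exact: subset_closure. Qed.

Lemma Ck_cst0 k : Ck k (fun _ : Rd => 0 : R).
Proof.
elim: k => [|k IH]; split => //; try by move=> x; exact: cst_continuous.
move=> j; split; first by move=> x; exact: derivable_cst.
rewrite (_ : partial j _ = fun=> 0)//.
by apply/funext => x; exact: derive_cst.
Qed.

Lemma test_function_cst0 (Omega : set Rd) :
  test_function Omega (fun _ : Rd => 0 : R).
Proof.
have K0 : [set x : Rd | (fun _ : Rd => 0 : R) x != 0] = set0.
  by apply/seteqP; split => // x /=; rewrite eqxx.
split; first by move=> k; exact: Ck_cst0.
- by rewrite K0 closure0; exact: compact0.
- by rewrite K0 closure0.
Qed.

Lemma test_function_setT (Omega : set Rd) phi :
  test_function Omega phi -> test_function setT phi.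
Proof. by case=> ? ? ?; split. Qed.

End TestFunctions.

(** * The fields phi e_i as elements of H^1 with zero trace *)

Section TestField.
Context {R : realType} {d : nat} (Omega : set 'rV[R]_d) (oO : open Omega).
Variables (phi : 'rV[R]_d -> R) (Tphi : test_function Omega phi) (i : 'I_d).

Definition test_field (x : 'rV[R]_d) : 'rV[R]_d := phi x *: delta_mx ord0 i.

Definition test_field_grad (x : 'rV[R]_d) : 'M[R]_d :=
  \matrix_(k, j) ((k == i)%:R * partial j phi x).

Let mO : measurable (Omega : set (volT R d)).
Proof. exact: open_vol_measurable. Qed.

Lemma test_fieldE x k : test_field x ord0 k = if k == i then phi x else 0.
Proof. by rewrite !mxE eqxx /=; case: ifP; rewrite ?mulr1 ?mulr0. Qed.

Lemma test_field_partial j k x :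
  partial j (fun y => test_field y ord0 k) x = test_field_grad x k j.
Proof.
have -> : (fun y => test_field y ord0 k) = fun y => if k == i then phi y else 0.
  by apply/funext => y; exact: test_fieldE.
rewrite mxE; case: (k == i); first by rewrite mul1r.
by rewrite mul0r; exact: derive_cst.
Qed.

Lemma test_field_L2 : L2 (vol R d) Omega test_field.
Proof.
have [Cphi cK _] := Tphi; have [cphi _] := Cphi 0%N.
apply: (@L2_le_sqr _ _ _ _ _ mO _ _ _ (fun x => phi x * phi x)).
- move=> k j; rewrite ord1; under eq_fun do rewrite test_fieldE.
  by case: (j == i); [exact: continuous_vol_measurable|exact: measurable_cst].
- apply: compact_support_integrable cK _ mO; first exact: continuous_mul.
  by move=> x; rewrite mulf_eq0 orbb => phix; exact: subset_closure.
- apply: aeW => x _; rewrite /frob big_ord1 (bigD1 i)//= big1 ?addr0 => [|j ji].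
    by rewrite test_fieldE eqxx.
  by rewrite test_fieldE (negbTE ji) mulr0.
Qed.

Lemma test_field_grad_L2 : L2 (vol R d) Omega test_field_grad.
Proof.
have [Cphi cK _] := Tphi; have [_ dphi] := Cphi 1%N.
apply: (@L2_le_sqr _ _ _ _ _ mO _ _ _
    (fun x => \sum_j partial j phi x * partial j phi x)).
- move=> k j; under eq_fun do rewrite mxE.
  apply: measurable_funM => //; apply: continuous_vol_measurable.
  by have [_ []] := dphi j.
- have -> : EFin \o (fun x => \sum_j partial j phi x * partial j phi x) =
      (fun x => \sum_j (partial j phi x * partial j phi x)%:E)%E.
    by apply/funext => x; rewrite /= sumEFin.
  apply: integrable_sum => // j _; have [_ [cdphi _]] := dphi j.
  apply: compact_support_integrable cK _ mO; first exact: continuous_mul.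
  by move=> x; rewrite mulf_eq0 orbb => /partial_support.
- apply: aeW => x _; rewrite /frob (bigD1 i)//= [X in _ + X]big1 ?addr0 => [|k ki].
    by apply: ler_sum => j _; rewrite mxE eqxx mul1r.
  by apply: big1 => j _; rewrite mxE (negbTE ki) !mul0r.
Qed.

Lemma test_field_weak_grad : weak_grad Omega test_field test_field_grad.
Proof.
move=> psi Tpsi k j; have [Cphi cK _] := Tphi; have [Cpsi _ _] := Tpsi.
under eq_Rintegral do rewrite test_fieldE.
under [in RHS]eq_Rintegral do rewrite mxE.
have [_|_] := eqVneq k i; last first.
  under eq_Rintegral do rewrite mul0r.
  under [in RHS]eq_Rintegral do rewrite !mul0r.
  by rewrite Rintegral_cst// mul0r oppr0.
under [in RHS]eq_Rintegral do rewrite mul1r.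
rewrite (@Rintegral_supported _ _ Omega); last first.
  by move=> x; rewrite mulf_eq0 negb_or => /andP[/(test_function_supp Tphi)].
rewrite (@Rintegral_supported _ _ Omega); last first.
  by move=> x; rewrite mulf_eq0 negb_or => /andP[_ /(test_function_supp Tpsi)].
exact: (Rintegral_by_parts _ (Cphi 1%N) (Cpsi 1%N) cK).
Qed.

Definition test_H1 : H1 Omega :=
  MkH1 test_field_L2 test_field_grad_L2 test_field_weak_grad.

(** The constant sequence equal to the field itself is an admissible approximation. It vanishes on
    the boundary because phi is supported in Omega, and an open set is disjoint from its
    boundary. *)
Lemma test_H1_trace0 (Gamma : set 'rV[R]_d) : is_trace0 Gamma test_H1 (fun=> 0).
Proof.
split; last exact: aeW.
have L0 : L2norm_sqr (surf R d) (boundary Omega) (fun=> 0 : 'rV[R]_d) = 0%E.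
  by apply: integral0_eq => x _; rewrite frob0l.
split; first by split; [move=> k j; exact: measurable_cst|rewrite L0].
exists (fun=> test_field); split.
- move=> _ k; under eq_fun do rewrite test_fieldE.
  by case: (k == i); [exact: test_function_setT Tphi|exact: test_function_cst0].
- rewrite (_ : L2norm_sqr _ _ _ = 0%E); first exact: cvg_cst.
  by rewrite /L2norm_sqr; apply: integral0_eq => x _; rewrite subrr frob0l.
- rewrite (_ : L2norm_sqr _ _ _ = 0%E); first exact: cvg_cst.
  rewrite /L2norm_sqr; apply: integral0_eq => x _.
  rewrite (_ : _ - _ = 0) ?frob0l//; apply/matrixP => k j.
  by rewrite [LHS]mxE [X in _ + X]mxE mxE test_field_partial subrr mxE.
- rewrite (_ : L2norm_sqr _ _ _ = 0%E); first exact: cvg_cst.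
  rewrite /L2norm_sqr; apply: integral0_eq => x [_ nOx]; rewrite subr0.
  have [phi0|/(test_function_supp Tphi) Ox] := eqVneq (phi x) 0.
    by rewrite /test_field phi0 scale0r frob0l.
  by case: nOx; apply: open_nbhs_nbhs; split.
Qed.

End TestField.

(** * Bilinear forms in finite dimension *)

Section FiniteDimension.
Context {K : fieldType} {X : vectType K}.

Lemma coord_vbasis_sum (v : X) :
  v = \sum_i coord (vbasis {:X}) i v *: (vbasis {:X})`_i.
Proof. by apply: coord_basis; [exact: vbasisP|exact: memvf]. Qed.

Section Functional.
Variable l : X -> K.
Hypothesis lL : forall a v w, l (a *: v + w) = a * l v + l w.

Lemma functional0 : l 0 = 0.
Proof.
have := lL 1 0 0; rewrite scaler0 add0r mul1r => /eqP.
by rewrite -subr_eq subrr eq_sym => /eqP.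
Qed.

Lemma functionalD v w : l (v + w) = l v + l w.
Proof. by rewrite -[v]scale1r lL mul1r scale1r. Qed.

Lemma functionalZ a v : l (a *: v) = a * l v.
Proof. by rewrite -[a *: v]addr0 lL functional0 addr0. Qed.

Lemma functionalB v w : l (v - w) = l v - l w.
Proof. by rewrite functionalD -scaleN1r functionalZ mulN1r. Qed.

Lemma functional_sum n (c : 'I_n -> K) (e : 'I_n -> X) :
  l (\sum_i c i *: e i) = \sum_i c i * l (e i).
Proof.
rewrite (big_morph l functionalD functional0); apply: eq_bigr => i _.
exact: functionalZ.
Qed.

Lemma functional_coord v :
  l v = \sum_i coord (vbasis {:X}) i v * l (vbasis {:X})`_i.
Proof. by rewrite {1}(coord_vbasis_sum v) functional_sum. Qed.

End Functional.

(** Algebraic form of Lax-Milgram. Definiteness makes the matrix M of B in a basis injective, hence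
    invertible, and the coordinates of u solve c M = (l(e_j))_j. *)
Lemma functional_representation (B : X -> X -> K) (l : X -> K) :
  (forall z a v w, B (a *: v + w) z = a * B v z + B w z) ->
  (forall z a v w, B z (a *: v + w) = a * B z v + B z w) ->
  (forall v, B v v = 0 -> v = 0) ->
  (forall a v w, l (a *: v + w) = a * l v + l w) ->
  exists2 u, (forall v, B u v = l v) &
    (forall u', (forall v, B u' v = l v) -> u = u').
Proof.
move=> Bl Br Bdef lL; set n := \dim {:X}; pose e (i : 'I_n) := (vbasis {:X})`_i.
pose M : 'M[K]_n := \matrix_(i, j) B (e i) (e j).
have combM (c : 'rV[K]_n) j : B (\sum_i c ord0 i *: e i) (e j) = (c *m M) ord0 j.
  rewrite (functional_sum (l := B^~ (e j))); last exact: Bl.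
  by rewrite mxE; apply: eq_bigr => i _; rewrite mxE.
have Mfree : row_free M.
  apply: inj_row_free => c cM0; set u := \sum_i c ord0 i *: e i.
  have u0 : u = 0.
    apply: Bdef; rewrite {2}/u functional_sum; last exact: Br.
    by apply: big1 => j _; rewrite combM cM0 mxE mulr0.
  have /freeP cfree := basis_free (vbasisP {:X}).
  by apply/rowP => i; rewrite [RHS]mxE; exact: cfree u0 i.
pose c : 'rV[K]_n := (\row_j l (e j)) *m invmx M.
exists (\sum_i c ord0 i *: e i) => [v|u' u'P].
  rewrite (functional_coord (Br _) v) [RHS](functional_coord lL v); apply: eq_bigr => j _.
  congr (_ * _); rewrite combM mulmxKV ?mxE//.
  by rewrite -row_free_unit.
(* Two solutions u and u' satisfy B (u - u') (u - u') = 0. *)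
apply/eqP; rewrite -subr_eq0; apply/eqP/Bdef.
set u := \sum_i _; rewrite (functionalB (Bl _)) u'P.
suff -> : B u (u - u') = l (u - u') by rewrite subrr.
rewrite (functional_coord (Br _) _) [RHS](functional_coord lL _); apply: eq_bigr => j _.
by congr (_ * _); rewrite combM mulmxKV ?mxE// -row_free_unit.
Qed.

End FiniteDimension.

(** * Elasticity tensors *)

Section TensorApplication.
Context {R : realType} {d : nat}.
Implicit Types (C : tensor4 R d) (A B : 'M[R]_d).

Lemma tappD C A B : tapp C (A + B) = tapp C A + tapp C B.
Proof.
apply/matrixP => i j; rewrite !mxE -big_split; apply: eq_bigr => k _.
by rewrite -big_split; apply: eq_bigr => l _; rewrite mxE mulrDr.
Qed.

Lemma tappZ C (a : R) A : tapp C (a *: A) = a *: tapp C A.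
Proof.
apply/matrixP => i j; rewrite !mxE mulr_sumr; apply: eq_bigr => k _.
by rewrite mulr_sumr; apply: eq_bigr => l _; rewrite mxE mulrCA.
Qed.

Lemma tappB C A B : tapp C (A - B) = tapp C A - tapp C B.
Proof. by rewrite tappD -scaleN1r tappZ scaleN1r. Qed.

(** [topnorm] is a supremum over the unit ball, so a nonzero A is first divided by its norm. *)
Lemma fnorm_tapp_le C (s : R) A : (topnorm C <= s%:E)%E ->
  fnorm (tapp C A) <= s * fnorm A.
Proof.
move=> Cs; have [A0|A0] := eqVneq (fnorm A) 0.
  rewrite A0 mulr0 (fnorm_eq0 A0) -(scale0r 0) tappZ scale0r.
  by rewrite /fnorm frob0l sqrtr0.
have A_gt0 : 0 < fnorm A by rewrite lt_neqAle eq_sym A0 fnorm_ge0.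
rewrite -ler_pdivrMr// -lee_fin; apply: le_trans Cs.
apply: ereal_sup_ubound; exists ((fnorm A)^-1 *: A) => /=.
  by rewrite fnormZ ger0_norm ?invr_ge0 ?fnorm_ge0// mulVf.
by rewrite tappZ fnormZ ger0_norm ?invr_ge0 ?fnorm_ge0// mulrC.
Qed.

End TensorApplication.

Section ElasticityTensor.
Context {disp : measure_display} {T : measurableType disp} {R : realType}.
Context {mu : {measure set T -> \bar R}} {D : set T} (mD : measurable D).
Context {d : nat} (C : T -> tensor4 R d) (sigma_up sigma_lo : R).
Hypothesis Cm : forall i j k l, measurable_fun D (fun x => C x i j k l).
Hypothesis Cae : {ae mu, forall x, D x -> forall tau omega : 'M[R]_d,
    [/\ frob (tapp (C x) tau) omega = frob tau (tapp (C x) omega),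
        (tapp (C x) tau)^T = tapp (C x) tau^T,
        (topnorm (C x) <= sigma_up%:E)%E &
        sigma_lo * fnorm tau ^+ 2 <= frob (tapp (C x) tau) tau]}.
Hypothesis up_ge0 : 0 <= sigma_up.
Implicit Types f g : T -> 'M[R]_d.

Lemma L2_sym f : L2 mu D f -> L2 mu D (fun x => sym (f x)).
Proof.
move=> Lf; apply: (L2_le mD (c := 1) _ Lf).
- move=> i j; under eq_fun do rewrite !mxE.
  by apply: measurable_funM => //; apply: measurable_funD; exact: Lf.1.
- by apply: aeW => x _; rewrite mul1r frob_sym_le.
Qed.

Lemma L2norm_sym_le f : L2 mu D f ->
  L2norm mu D (fun x => sym (f x)) <= L2norm mu D f.
Proof.
move=> Lf; rewrite -[leRHS]mul1r; apply: L2norm_le => //; first exact: L2_sym.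
by apply: aeW => x _; rewrite expr1n mul1r frob_sym_le.
Qed.

Lemma mx_measurable_tapp f : mx_measurable D f ->
  mx_measurable D (fun x => tapp (C x) (f x)).
Proof.
move=> mf i j; under eq_fun do rewrite mxE.
apply: measurable_sum => k; apply: measurable_sum => l.
by apply: measurable_funM => //; exact: Cm.
Qed.

Lemma tapp_frob_le f : {ae mu, forall x, D x ->
  frob (tapp (C x) (f x)) (tapp (C x) (f x)) <= sigma_up ^+ 2 * frob (f x) (f x)}.
Proof.
apply: (aeS _ Cae) => x Cx Dx; have [_ _ Cup _] := Cx Dx 0 0.
rewrite -!fnorm_sqr -exprMn ler_sqr ?nnegrE ?mulr_ge0 ?fnorm_ge0//.
exact: fnorm_tapp_le.
Qed.

Lemma L2_tapp f : L2 mu D f ->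
  L2 mu D (fun x => tapp (C x) (f x)).
Proof.
move=> Lf; apply: (L2_le mD _ Lf (tapp_frob_le f)).
by apply: mx_measurable_tapp; exact: Lf.1.
Qed.

Lemma L2norm_tapp_le f : L2 mu D f ->
  L2norm mu D (fun x => tapp (C x) (f x)) <= sigma_up * L2norm mu D f.
Proof.
move=> Lf; apply: L2norm_le => //; first exact: L2_tapp.
exact: tapp_frob_le.
Qed.

Lemma ip_tapp_coercive f : L2 mu D f ->
  sigma_lo * ip mu D f f <= ip mu D (fun x => tapp (C x) (f x)) f.
Proof.
move=> Lf; have LCf := L2_tapp Lf; have Lsf := L2Z mD sigma_lo Lf.
rewrite -subr_ge0 -ipZl// -ipBl// /ip; set k := fun x => frob _ _.
have mk : measurable_fun D k.
  apply: measurable_frob; last exact: Lf.1.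
  by have [] := L2B mD LCf Lsf.
(* Coercivity makes the integrand nonnegative almost everywhere only; it is therefore replaced by
   its absolute value, which is nonnegative everywhere. *)
rewrite (@ae_eq_Rintegral _ _ _ _ _ mD _ (fun x => `|k x|)) //.
- by apply: Rintegral_ge0 => x _; exact: normr_ge0.
- exact: measurableT_comp.
- apply: (aeS _ Cae) => x Cx Dx; have [_ _ _ Clo] := Cx Dx (f x) 0.
  rewrite ger0_norm// /k frobDl frobNl frobZl subr_ge0.
  by move: Clo; rewrite fnorm_sqr.
Qed.

Lemma tapp_sym_tr f : {ae mu, forall x, D x ->
  (tapp (C x) (sym (f x)))^T = tapp (C x) (sym (f x))}.
Proof.
apply: (aeS _ Cae) => x Cx Dx.
by have [_ -> _ _] := Cx Dx (sym (f x)) 0; rewrite sym_tr.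
Qed.

(** The stress is symmetric almost everywhere, so it can be tested against full gradients instead of
    their symmetric parts. This links the elastic forms, written with strains, to [is_div] and
    [gd_W], written with gradients. *)
Lemma ip_tapp_sym f g : L2 mu D f -> L2 mu D g ->
  ip mu D (fun x => tapp (C x) (sym (f x))) (fun x => sym (g x)) =
  ip mu D (fun x => tapp (C x) (sym (f x))) g.
Proof.
move=> Lf Lg; have [mCf _] := L2_tapp (L2_sym Lf); apply: ae_eq_Rintegral => //.
- by apply: measurable_frob => //; have [] := L2_sym Lg.
- by apply: measurable_frob => //; have [] := Lg.
- by apply: (aeS _ (tapp_sym_tr f)) => x Cx Dx; rewrite frob_sym// Cx.
Qed.

End ElasticityTensor.

(** * Infima and maxima in the extended reals *)

Section ErealBounds.
Context {R : realType}.

(** For finite x each inequality rearranges to (a - x) / b <= s v, which passes to the infimum. The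
    value x = +oo must be allowed because x will contain [gd_W]. *)
Lemma lee_affine_ereal_inf {I : Type} (a b : R) (x : \bar R) (s : I -> R) :
  0 < b -> (0 <= x)%E -> (forall v, 0 <= s v) ->
  (forall v, a%:E <= x + (b * s v)%:E)%E ->
  (a%:E <= x + b%:E * ereal_inf [set (s v)%:E | v in [set: I]])%E.
Proof.
move=> b0 x0 s0 H; set S := ereal_inf _.
have S0 : (0 <= S)%E by apply: le_ereal_inf_tmp => _ [v _ <-]; rewrite lee_fin.
case: x x0 H => [x| |] x0 H; last first.
- by [].
(* Nonnegativity excludes the value -oo, whose sum with +oo would not be +oo. *)
- have bS : (0 <= b%:E * S)%E by rewrite mule_ge0// lee_fin ltW.
  by rewrite addye ?leey//; case: (_ * _)%E bS.
have aS : (((a - x) / b)%:E <= S)%E.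
  apply: le_ereal_inf_tmp => _ [v _ <-]; rewrite lee_fin ler_pdivrMr//.
  by have := H v; rewrite -EFinD lee_fin mulrC; lra.
have := lee_wpmul2l _ aS; move=> /(_ b%:E); rewrite lee_fin ltW// => /(_ isT).
rewrite -EFinM mulrCA divff ?gt_eqF// mulr1 => bS.
apply: le_trans (leeD2l x%:E bS); rewrite -EFinD lee_fin; lra.
Qed.

Lemma gd_max_ub (A : set (\bar R)) r : A r -> (r <= gd_max A)%E.
Proof. by move=> Ar; apply: ereal_sup_ubound; right. Qed.

Lemma gd_max_ge0 (A : set (\bar R)) : (0 <= gd_max A)%E.
Proof. by apply: ereal_sup_ubound; left. Qed.

Lemma gd_max_le (A : set (\bar R)) (M : R) : 0 <= M ->
  (forall r, A r -> (r <= M%:E)%E) -> (gd_max A <= M%:E)%E.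
Proof.
by move=> M0 AM; apply: ge_ereal_sup => r [->|/AM//]; rewrite lee_fin.
Qed.

End ErealBounds.

(** * Abstract schemes *)

Section LinearFields.
Context {disp : measure_display} {T : measurableType disp} {R : realType}.
Context {mu : {measure set T -> \bar R}} {D : set T} (mD : measurable D).
Context {X : vectType R}.

(** Stated over an arbitrary measure space because reconstructions and gradients live on Omega while
    discrete traces live on GammaN with the surface measure. *)
Definition ae_linear {m n} (P : X -> T -> 'M[R]_(m, n)) := forall a v w,
  {ae mu, forall x, D x -> P (a *: v + w) x = a *: P v x + P w x}.

Section LinearField.
Context {m n : nat} {P : X -> T -> 'M[R]_(m, n)}.
Hypotheses (PL2 : forall v, L2 mu D (P v)) (Plin : ae_linear P).

Lemma ip_linearl g a v w : L2 mu D g ->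
  ip mu D (P (a *: v + w)) g = a * ip mu D (P v) g + ip mu D (P w) g.
Proof.
move=> Lg; have La := L2Z mD a (PL2 v); have LP := L2D mD La (PL2 w).
rewrite (ae_eq_ip mD (PL2 _).1 LP.1 Lg.1 Lg.1 (Plin a v w)); last exact: aeW.
by rewrite ipDl// ipZl.
Qed.

Lemma ip_linearr g a v w : L2 mu D g ->
  ip mu D g (P (a *: v + w)) = a * ip mu D g (P v) + ip mu D g (P w).
Proof. by move=> Lg; rewrite ipC ip_linearl// !(ipC _ _ g). Qed.

Lemma L2normL a v : L2norm mu D (P (a *: v)) = `|a| * L2norm mu D (P v).
Proof.
have ipZ g : L2 mu D g -> ip mu D (P (a *: v)) g = a * ip mu D (P v) g.
  move=> Lg; apply: (functionalZ (l := fun v => ip mu D (P v) g)) => b u w.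
  exact: ip_linearl.
by rewrite !L2norm_ip ipZ// ipC ipZ// mulrA -expr2 sqrtrM ?sqr_ge0// sqrtr_sqr.
Qed.

Lemma L2norm_linear0 : L2norm mu D (P 0) = 0.
Proof. by rewrite -(scale0r 0) L2normL normr0 mul0r. Qed.

Lemma L2normDL v w :
  L2norm mu D (P (v + w)) <= L2norm mu D (P v) + L2norm mu D (P w).
Proof.
have Lvw := L2D mD (PL2 v) (PL2 w).
rewrite (@ae_eq_L2norm _ _ _ _ _ mD _ _ _ (fun x => P v x + P w x)).
- exact: L2norm_triangle.
- by have [] := PL2 (v + w).
- by have [] := Lvw.
- by apply: (aeS _ (Plin 1 v w)) => x + Dx; rewrite !scale1r => ->.
Qed.

Lemma L2norm_linearB v w :
  L2norm mu D (fun x => P v x - P w x) = L2norm mu D (P (v - w)).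
Proof.
have Lvw := L2B mD (PL2 v) (PL2 w).
apply: (ae_eq_L2norm mD); [by have [] := Lvw|by have [] := PL2 (v - w)|].
apply: (aeS _ (Plin (-1) w v)) => x + Dx.
by rewrite !scaleN1r ![- _ + _]addrC => ->.
Qed.

End LinearField.

(** Continuity of linear maps on a finite-dimensional normed space, obtained from Riesz
    representation of the coordinates instead of compactness of the unit sphere. P may live on
    another measure space than G, so that the lemma serves both quotients in C_D. *)
Lemma L2norm_linear_bounded m n p q (G : X -> T -> 'M[R]_(p, q))
    {disp' : measure_display} {S : measurableType disp'}
    {nu : {measure set S -> \bar R}} {E : set S} (P : X -> S -> 'M[R]_(m, n)) :
  (forall v, L2 mu D (G v)) -> ae_linear G ->
  (forall v, L2norm mu D (G v) = 0 -> v = 0) ->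
  (forall a v, L2norm nu E (P (a *: v)) = `|a| * L2norm nu E (P v)) ->
  (forall v w, L2norm nu E (P (v + w)) <= L2norm nu E (P v) + L2norm nu E (P w)) ->
  exists2 M, 0 <= M & forall v, L2norm nu E (P v) <= M * L2norm mu D (G v).
Proof.
move=> GL2 Glin Gdef PZ PD; set e := vbasis {:X}.
(* Each coordinate of v is an inner product with a fixed field, hence is
   bounded by the norm of v. *)
have coordP i : exists z, forall v, ip mu D (G z) (G v) = coord e i v.
  have [||||z zP _] := @functional_representation _ X
    (fun v w => ip mu D (G v) (G w)) (coord e i).
  - by move=> z a v w; exact: ip_linearl.
  - by move=> z a v w; exact: ip_linearr.
  - by move=> v v0; apply: Gdef; rewrite L2norm_ip v0 sqrtr0.
  - by move=> a v w; rewrite linearP.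
  - by exists z.
have [z zP] := choice coordP.
(* By Cauchy-Schwarz the first factor bounds the i-th coordinate form. *)
exists (\sum_i L2norm mu D (G (z i)) * L2norm nu E (P e`_i)).
  by apply: sumr_ge0 => i _; rewrite mulr_ge0// L2norm_ge0.
move=> v; rewrite {1}(coord_vbasis_sum v) mulr_suml.
pose N u := L2norm nu E (P u).
have N0 : N 0 = 0 by rewrite /N -(scale0r 0) PZ normr0 mul0r.
have /le_trans : N (\sum_i coord e i v *: e`_i) <= \sum_i N (coord e i v *: e`_i).
  elim/big_ind2: _ => [|a u b w au bw|//]; first by rewrite N0.
  by apply: le_trans (PD _ _) _; exact: lerD.
apply; apply: ler_sum => i _; rewrite /N PZ mulrAC.
by rewrite ler_wpM2r ?L2norm_ge0// -zP ip_le_norm.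
Qed.

End LinearFields.

(** * Well-posedness and error of an abstract scheme *)

Section Scheme.
Context {disp disp' : measure_display} {T : measurableType disp}
  {S : measurableType disp'} {R : realType}.
Context {mu : {measure set T -> \bar R}} {D : set T} (mD : measurable D).
Context {nu : {measure set S -> \bar R}} {E : set S} (mE : measurable E).
Context {d : nat} (C : T -> tensor4 R d) (sigma_up sigma_lo : R).
Hypothesis Cm : forall i j k l, measurable_fun D (fun x => C x i j k l).
Hypothesis Cae : {ae mu, forall x, D x -> forall tau omega : 'M[R]_d,
    [/\ frob (tapp (C x) tau) omega = frob tau (tapp (C x) omega),
        (tapp (C x) tau)^T = tapp (C x) tau^T,
        (topnorm (C x) <= sigma_up%:E)%E &
        sigma_lo * fnorm tau ^+ 2 <= frob (tapp (C x) tau) tau]}.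
Hypotheses (up_ge0 : 0 <= sigma_up) (lo_gt0 : 0 < sigma_lo).
Context {X : vectType R} (Pi : X -> T -> 'rV[R]_d) (Tr : X -> S -> 'rV[R]_d)
  (G : X -> T -> 'M[R]_d).
Hypotheses (PiL2 : forall v, L2 mu D (Pi v)) (TrL2 : forall v, L2 nu E (Tr v))
  (GL2 : forall v, L2 mu D (G v)).
Hypotheses (Pilin : ae_linear (mu := mu) (D := D) Pi)
  (Trlin : ae_linear (mu := nu) (D := E) Tr)
  (Glin : ae_linear (mu := mu) (D := D) G).
Context (F : T -> 'rV[R]_d) (g : S -> 'rV[R]_d).
Hypotheses (FL2 : L2 mu D F) (gL2 : L2 nu E g).
Context (k : R) (k_ge0 : 0 <= k).
Local Notation eps v := (fun x => sym (G v x)).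
Local Notation stress v := (fun x => tapp (C x) (sym (G v x))).
Local Notation normD := (L2norm mu D).
Local Notation ipD := (ip mu D).
Hypothesis korn : forall v, normD (G v) <= k * normD (eps v).
Hypothesis Gdef : forall v, normD (G v) = 0 -> v = 0.

Let epsL2 v : L2 mu D (eps v) := L2_sym mD (GL2 v).
Let stressL2 v : L2 mu D (stress v) := L2_tapp mD Cm Cae up_ge0 (epsL2 v).

Let epslin : ae_linear (mu := mu) (D := D) (fun v => eps v).
Proof.
by move=> a v w; apply: (aeS _ (Glin a v w)) => x GE Dx; rewrite GE// symD symZ.
Qed.

Let stresslin : ae_linear (mu := mu) (D := D) (fun v => stress v).
Proof.
move=> a v w; apply: (aeS _ (Glin a v w)) => x GE Dx.
by rewrite GE// symD symZ tappD tappZ.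
Qed.

Definition scheme_form (u v : X) : R := ipD (stress u) (eps v).
Definition scheme_load (v : X) : R := ipD F (Pi v) + ip nu E g (Tr v).

Lemma scheme_coercive v :
  sigma_lo * normD (eps v) ^+ 2 <= scheme_form v v.
Proof.
by rewrite L2norm_sq; exact: (ip_tapp_coercive mD Cm Cae up_ge0).
Qed.

(** Definiteness of the form is a chain: a(v, v) = 0 gives a zero discrete strain by coercivity,
    then a zero discrete gradient by [korn], then v = 0 by [Gdef]. *)
Lemma scheme_wellposed :
  exists2 u, (forall v, scheme_form u v = scheme_load v) &
    (forall u', (forall v, scheme_form u' v = scheme_load v) -> u = u').
Proof.
apply: functional_representation.
- by move=> z a v w; rewrite /scheme_form (ip_linearl mD _ stresslin).
- by move=> z a v w; rewrite /scheme_form (ip_linearr mD _ epslin).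
- move=> v v0; apply: Gdef; apply/eqP; rewrite eq_le L2norm_ge0 andbT.
  have := scheme_coercive v; rewrite v0 pmulr_rle0// => ev0.
  have {}ev0 : normD (eps v) = 0.
    by apply/eqP; rewrite -sqrf_eq0 eq_le ev0 sqr_ge0.
  by rewrite (le_trans (korn v))// ev0 mulr0.
- move=> a v w; rewrite /scheme_load (ip_linearr mD _ Pilin)//.
  by rewrite (ip_linearr mE _ Trlin)// mulrDr addrACA.
Qed.

Section Error.
Variables (u : X) (Gu : T -> 'M[R]_d) (w : R).
Hypothesis w_ge0 : 0 <= w.
Hypothesis uP : forall v, scheme_form u v = scheme_load v.
Hypothesis GuL2 : L2 mu D Gu.
Local Notation sigma := (fun x => tapp (C x) (sym (Gu x))).
Hypothesis residual : forall v, v != 0 ->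
  ipD (G v) sigma - scheme_load v <= w * normD (G v).

(** Coercivity bounds the squared norm of v - u by a multiple of the norm itself, which is then
    divided out. The factor k ^+ 2 comes from squaring [korn]; w stands for a finite value of
    W_D. *)
Lemma scheme_error v :
  sigma_lo * normD (G (v - u)) <=
  k ^+ 2 * (w + sigma_up * normD (fun x => G v x - Gu x)).
Proof.
set e := v - u; set s := normD (fun x => G v x - Gu x).
(* The final division by the norm of e, and the use of [residual], require e to be nonzero. *)
have [e0|e0] := eqVneq (normD (G e)) 0.
  by rewrite e0 mulr0 mulr_ge0 ?sqr_ge0// addr_ge0// mulr_ge0// L2norm_ge0.
have e_neq0 : e != 0.
  by apply: contra_neq e0 => ->; exact: (L2norm_linear0 mD GL2 Glin).
have sq_le :
  sigma_lo * normD (G e) ^+ 2 <= k ^+ 2 * ((w + sigma_up * s) * normD (G e)).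
  have k2 : normD (G e) ^+ 2 <= k ^+ 2 * normD (eps e) ^+ 2.
    by rewrite -exprMn ler_sqr ?nnegrE ?mulr_ge0 ?L2norm_ge0.
  apply: (@le_trans _ _ (k ^+ 2 * (sigma_lo * normD (eps e) ^+ 2))).
    by rewrite [leRHS]mulrCA ler_pM2l.
  rewrite ler_wpM2l ?sqr_ge0//; apply: le_trans (scheme_coercive e) _.
  have GuS : L2 mu D sigma := L2_tapp mD Cm Cae up_ge0 (L2_sym mD GuL2).
  (* Here a(e, e) = a(v, e) - a(u, e), with a(u, e) equal to the load of e. The pairing of [sigma]
     with the strain of e is subtracted from a(v, e) and added back as a pairing with the gradient
     of e. *)
  have -> : scheme_form e e =
      ipD (fun x => tapp (C x) (sym (G v x - Gu x))) (eps e) +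
      (ipD (G e) sigma - scheme_load e).
    rewrite -uP (ipC mu D (G e)) -(ip_tapp_sym mD Cm Cae up_ge0 GuL2 (GL2 e)).
    have -> : scheme_form e e = scheme_form v e - scheme_form u e.
      by apply: (functionalB (l := scheme_form^~ e)) => a x y;
         rewrite /scheme_form (ip_linearl mD _ stresslin).
    rewrite addrA; congr (_ - _).
    rewrite (_ : (fun x => tapp _ _) = fun x => stress v x - sigma x).
      by rewrite ipBl// subrK.
    by apply/funext => x; rewrite symB tappB.
  have ee : normD (eps e) <= normD (G e) by exact: L2norm_sym_le.
  have LB := L2B mD (GL2 v) GuL2.
  rewrite mulrDl addrC lerD ?residual//; apply: le_trans (ler_norm _) _.
  apply: le_trans (ip_le_norm mD _ (epsL2 e)) _.
    by apply: (L2_tapp mD Cm Cae up_ge0); exact: (L2_sym mD).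
  apply: ler_pM; rewrite ?L2norm_ge0//.
  apply: le_trans (L2norm_tapp_le mD Cm Cae up_ge0 _) _; first exact: (L2_sym mD).
  by rewrite ler_wpM2l// L2norm_sym_le.
have e_gt0 : 0 < normD (G e) by rewrite lt_neqAle eq_sym e0 L2norm_ge0.
by rewrite -(ler_pM2r e_gt0) -mulrA -expr2 -mulrA.
Qed.

End Error.
End Scheme.

(** * The continuous stress *)

Section WeakSolution.
Context {R : realType} {d : nat} {Omega GammaD GammaN : set 'rV[R]_d}.
Variables (C : 'rV[R]_d -> tensor4 R d) (sigma_up sigma_lo : R).
Variables (F g : 'rV[R]_d -> 'rV[R]_d) (u : H1 Omega).
Hypothesis oO : open Omega.
Hypotheses (FL2 : L2 (vol R d) Omega F) (gL2 : L2 (surf R d) GammaN g).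
Hypothesis up_ge0 : 0 <= sigma_up.
Hypothesis Cel : is_elasticity_tensor Omega C sigma_up sigma_lo.
Hypothesis u_sol : weak_solution GammaD GammaN C F g u.
Local Notation sigma := (fun x => tapp (C x) (eps u x)).

Let mO : measurable (Omega : set (volT R d)) := open_vol_measurable oO.

Lemma stress_L2 : L2 (vol R d) Omega sigma.
Proof. exact: (L2_tapp mO Cel.1 Cel.2 up_ge0 (L2_sym mO (grad_L2 u))). Qed.

Lemma stress_gradE (v : H1 Omega) :
  \int[vol R d]_(x in Omega) frob (tapp (C x) (eps u x)) (eps v x) =
  ip (vol R d) Omega sigma (grad v).
Proof. exact: (ip_tapp_sym mO Cel.1 Cel.2 up_ge0 (grad_L2 u) (grad_L2 v)). Qed.

(** The test field phi e_i has zero trace, so the boundary term of the weak formulation vanishes,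
    and only row i of the stress meets its gradient. *)
Lemma stress_is_div : is_div Omega sigma (fun x => - F x).
Proof.
split; first exact: (L2N mO FL2).
move=> phi Tphi i; pose v := test_H1 oO Tphi i.
have := u_sol.2 v _ (test_H1_trace0 oO Tphi i GammaD).
rewrite stress_gradE.
have -> : \int[surf R d]_(x in GammaN) frob (g x) (0 : 'rV[R]_d) = 0.
  under eq_Rintegral do rewrite frobC frob0l.
  by rewrite /Rintegral integral0.
rewrite addr0 => weak.
have -> : \int[vol R d]_(x in Omega) (\sum_j sigma x i j * partial j phi x) =
    ip (vol R d) Omega sigma (grad v).
  apply: eq_Rintegral => x _; rewrite [RHS](bigD1 i)//= [X in _ + X]big1 ?addr0.
    by apply: eq_bigr => j _; rewrite [X in _ = _ * X]mxE eqxx mul1r.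
  move=> k ki; apply: big1 => j _.
  by rewrite [X in _ * X]mxE (negbTE ki) mul0r mulr0.
have -> : \int[vol R d]_(x in Omega) ((- F x) ord0 i * phi x) =
    ip (vol R d) Omega (fun x => - F x) v.
  apply: eq_Rintegral => x _; rewrite [RHS]big_ord1 (bigD1 i)//= big1 ?addr0.
    by rewrite test_fieldE eqxx.
  by move=> j ji; rewrite test_fieldE (negbTE ji) mulr0.
by rewrite weak (ipNl mO FL2 (H1_fun_L2 v)) opprK.
Qed.

Hypothesis GammaE : boundary Omega `\` GammaN = GammaD.

(** By [GammaE] the traces that vanish outside GammaN are those admissible in the weak formulation.
    As the divergence is - F, the volume load cancels and the boundary load remains. *)
Lemma stress_is_normal_trace :
  is_normal_trace Omega GammaN sigma (fun x => - F x) g.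
Proof.
split => // v t; rewrite GammaE => vt; have := u_sol.2 v t vt.
rewrite stress_gradE => weak.
rewrite RintegralD//.
- rewrite -/(ip (vol R d) Omega sigma (grad v)) weak.
  rewrite -/(ip (vol R d) Omega (fun x => - F x) v).
  by rewrite (ipNl mO FL2 (H1_fun_L2 v)) addrAC subrr add0r.
- exact: (L2_integrable mO stress_L2 (grad_L2 v)).
- exact: (L2_integrable mO (L2N mO FL2) (H1_fun_L2 v)).
Qed.

Lemma stress_Hdiv : Hdiv Omega GammaN sigma.
Proof.
split; first exact: stress_L2.
exists (fun x => - F x), g.
by split; [exact: stress_is_div|exact: stress_is_normal_trace].
Qed.

End WeakSolution.

(** * Gradient discretisations *)

Section GradientDiscretisation.
Context {R : realType} {d : nat} {Omega GammaN : set 'rV[R]_d}.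
Variable D : gradient_discretisation Omega GammaN.
Hypothesis mO : measurable (Omega : set (volT R d)).
Hypothesis mN : measurable (GammaN : set (surfT R d)).

Lemma gd_norm_gt0 (v : gd_X D) : v != 0 -> 0 < gd_norm v.
Proof.
move=> v0; rewrite lt_neqAle L2norm_ge0 andbT eq_sym.
by apply: contra_neq v0; exact: gd_definite.
Qed.

Lemma gd_norm0 : gd_norm (0 : gd_X D) = 0.
Proof.
exact: (L2norm_linear0 mO (@gd_grad_L2 _ _ _ _ D) (@gd_grad_linear _ _ _ _ D)).
Qed.

(** Discrete Korn inequality, which supplies the hypothesis [korn] of the abstract scheme. *)
Lemma gd_K_ge (v : gd_X D) (k : R) : gd_K D = k%:E ->
  gd_norm v <= k * L2norm (vol R d) Omega (gd_eps v).
Proof.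
move=> Kk; have [->|v0] := eqVneq v 0.
  by rewrite gd_norm0 mulr_ge0 ?L2norm_ge0// -lee_fin -Kk gd_max_ge0.
have vK : ((gd_norm v)%:E / (L2norm (vol R d) Omega (gd_eps v))%:E <= k%:E)%E.
  by rewrite -Kk; apply: gd_max_ub; exists v.
have [e0|e0] := eqVneq (L2norm (vol R d) Omega (gd_eps v)) 0.
  (* The inverse of 0 is +oo in the extended reals, so a nonzero v with zero strain would make the
     quotient, hence K_D, infinite. *)
  suff : (+oo <= k%:E)%E by rewrite leye_eq.
  apply: le_trans vK; rewrite e0 inver eqxx.
  by rewrite gt0_muley// lte_fin gd_norm_gt0.
have e_gt0 : 0 < L2norm (vol R d) Omega (gd_eps v).
  by rewrite lt_neqAle eq_sym e0 L2norm_ge0.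
by move: vK; rewrite inver (negbTE e0) -EFinM lee_fin ler_pdivrMr.
Qed.

(** Both the reconstruction and the discrete trace are bounded by the norm of a finite-dimensional
    space; the sum M + N of the two constants bounds the maximum of the quotients. *)
Lemma gd_C_bound : exists c : R, [/\ gd_C D = c%:E, 0 <= c &
  forall v : gd_X D, L2norm (vol R d) Omega (gd_Pi v) <= c * gd_norm v].
Proof.
have GL2 := @gd_grad_L2 _ _ _ _ D; have Glin := @gd_grad_linear _ _ _ _ D.
have PL2 := @gd_Pi_L2 _ _ _ _ D; have Plin := @gd_Pi_linear _ _ _ _ D.
have TL2 := @gd_T_L2 _ _ _ _ D; have Tlin := @gd_T_linear _ _ _ _ D.
have [M M0 MP] := L2norm_linear_bounded mO GL2 Glin (@gd_definite _ _ _ _ D)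
  (L2normL mO PL2 Plin) (L2normDL mO PL2 Plin).
have [N N0 NP] := L2norm_linear_bounded mO GL2 Glin (@gd_definite _ _ _ _ D)
  (L2normL mN TL2 Tlin) (L2normDL mN TL2 Tlin).
have C_le : (gd_C D <= (M + N)%:E)%E.
  apply: gd_max_le; first exact: addr_ge0.
  move=> _ [v /= v0 <-]; rewrite lee_fin ge_max !ler_pdivrMr ?gd_norm_gt0// !mulrDl.
  by rewrite ler_wpDr ?mulr_ge0 ?L2norm_ge0//= ler_wpDl ?mulr_ge0 ?L2norm_ge0.
have C_ge0 : (0 <= gd_C D)%E by exact: gd_max_ge0.
have C_fin : gd_C D \is a fin_num.
  by rewrite ge0_fin_numE// (le_lt_trans C_le)// ltry.
exists (fine (gd_C D)); split; [by rewrite fineK|exact: fine_ge0|move=> v].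
(* The maximum runs over nonzero vectors; at 0 the reconstruction vanishes almost everywhere by
   linearity. *)
have [->|v0] := eqVneq v 0.
  rewrite gd_norm0 mulr0.
  by rewrite (L2norm_linear0 mO PL2 Plin).
rewrite -ler_pdivrMr ?gd_norm_gt0// -lee_fin fineK//.
apply: le_trans (gd_max_ub _); last by exists v.
by rewrite lee_fin le_max lexx.
Qed.

End GradientDiscretisation.

(** * Error estimates for the gradient scheme *)

Section ErrorEstimate.
Context {R : realType} {d : nat} {Omega GammaD GammaN : set 'rV[R]_d}.
Variables (C : 'rV[R]_d -> tensor4 R d) (sigma_up sigma_lo : R).
Variables (F g : 'rV[R]_d -> 'rV[R]_d) (u : H1 Omega).
Variable D : gradient_discretisation Omega GammaN.
Hypothesis oO : open Omega.
Hypothesis mN : measurable (GammaN : set (surfT R d)).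
Hypothesis GammaE : boundary Omega `\` GammaN = GammaD.
Hypotheses (FL2 : L2 (vol R d) Omega F) (gL2 : L2 (surf R d) GammaN g).
Hypotheses (up_ge0 : 0 <= sigma_up) (lo_gt0 : 0 < sigma_lo).
Hypothesis Cel : is_elasticity_tensor Omega C sigma_up sigma_lo.
Hypothesis u_sol : weak_solution GammaD GammaN C F g u.
Variables (k : R) (gd_KE : gd_K D = k%:E).
Local Notation sigma := (fun x => tapp (C x) (eps u x)).
Local Notation W := (gd_W D sigma).

Let mO : measurable (Omega : set (volT R d)) := open_vol_measurable oO.
Let GL2 := @gd_grad_L2 _ _ _ _ D.
Let Glin := @gd_grad_linear _ _ _ _ D.
Let PL2 := @gd_Pi_L2 _ _ _ _ D.
Let Plin := @gd_Pi_linear _ _ _ _ D.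
Let TL2 := @gd_T_L2 _ _ _ _ D.
Let Tlin := @gd_T_linear _ _ _ _ D.
Let korn v := @gd_K_ge _ _ _ _ D mO v k gd_KE.
Let load := scheme_load (mu := vol R d) (D := Omega) (nu := surf R d)
  (E := GammaN) (@gd_Pi _ _ _ _ D) (@gd_T _ _ _ _ D) F g.

Let k_ge0 : 0 <= k.
Proof. by rewrite -lee_fin -gd_KE; exact: gd_max_ge0. Qed.

Lemma gradient_scheme_wellposed :
  exists uD : gd_X D, unique (gradient_scheme C F g) uD.
Proof.
have [uD uP uU] := scheme_wellposed mO mN Cel.1 Cel.2 up_ge0 lo_gt0
  PL2 TL2 GL2 Plin Tlin Glin FL2 gL2 korn (@gd_definite _ _ _ _ D).
by exists uD; split.
Qed.

(** Among the representatives over which [gd_W] takes its supremum, - F for the divergence and g for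
    the normal trace turn the consistency defect into the residual of the scheme. *)
Lemma gd_W_ge (v : gd_X D) : v != 0 ->
  (((ip (vol R d) Omega (gd_grad v) sigma - load v) / gd_norm v)%:E <= W)%E.
Proof.
move=> v0; have Ls := stress_L2 u oO up_ge0 Cel.
have LnF : L2 (vol R d) Omega (fun x => - F x) := L2N mO FL2.
apply: (@le_trans _ _
  (`|ip (vol R d) Omega (gd_grad v) sigma - load v| / gd_norm v)%:E).
  by rewrite lee_fin ler_wpM2r ?invr_ge0 ?L2norm_ge0// ler_norm.
apply: gd_max_ub; exists v, (fun x => - F x), g; split => //.
- exact: (stress_is_div oO FL2 up_ge0 Cel u_sol).
- exact: (stress_is_normal_trace oO FL2 gL2 up_ge0 Cel u_sol GammaE).
- congr (`|_| / _)%:E.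
  rewrite RintegralD//.
  + rewrite -/(ip (vol R d) Omega (gd_grad v) sigma).
    rewrite -/(ip (vol R d) Omega (gd_Pi v) (fun x => - F x)).
    rewrite -/(ip (surf R d) GammaN g (gd_T v)).
    rewrite (ipC (vol R d) Omega (gd_Pi v)) (ipNl mO FL2 (PL2 v)).
    by rewrite /load /scheme_load opprD addrA.
  + exact: (L2_integrable mO (GL2 v) Ls).
  + exact: (L2_integrable mO (PL2 v) LnF).
Qed.

Variable uD : gd_X D.
Hypothesis uD_sol : gradient_scheme C F g uD.
Local Notation normO := (L2norm (vol R d) Omega).

(** For finite W_D this is [scheme_error] with w = W_D, divided by [sigma_lo]. *)
Lemma discrete_error (v : gd_X D) :
  ((gd_norm (v - uD))%:E <= (k ^+ 2 / sigma_lo)%:E * W +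
    (k ^+ 2 * sigma_up / sigma_lo *
     normO (fun x => gd_grad v x - grad u x))%:E)%E.
Proof.
have W0 : (0 <= W)%E by exact: gd_max_ge0.
set s := normO _; have s0 : 0 <= s by exact: L2norm_ge0.
have a0 : 0 <= k ^+ 2 / sigma_lo by rewrite divr_ge0 ?sqr_ge0// ltW.
have b0 : 0 <= k ^+ 2 * sigma_up / sigma_lo * s.
  by rewrite !mulr_ge0 ?sqr_ge0// invr_ge0 ltW.
(* If K_D = 0 then 0 * W = 0 even for W = +oo, so this case is separate. *)
have [kE|k_neq0] := eqVneq k 0.
  apply: (@le_trans _ _ 0%E); last by rewrite adde_ge0 ?mule_ge0 ?lee_fin.
  by rewrite lee_fin (le_trans (korn _))// kE mul0r.
have a_gt0 : 0 < k ^+ 2 / sigma_lo.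
  by rewrite divr_gt0// lt_neqAle eq_sym sqrf_eq0 k_neq0 sqr_ge0.
case: W W0 (@gd_W_ge) => [w| |] w0 Wge.
- rewrite -EFinM -EFinD lee_fin.
  have res (z : gd_X D) : z != 0 ->
      ip (vol R d) Omega (gd_grad z) sigma - load z <= w * gd_norm z.
    by move=> z0; have := Wge z z0; rewrite lee_fin ler_pdivrMr// gd_norm_gt0.
  have := scheme_error mO Cel.1 Cel.2 up_ge0 lo_gt0 GL2 Glin k_ge0 korn w0
    uD_sol (grad_L2 u) res v.
  rewrite -/(gd_norm (v - uD)) -/s => err.
  rewrite -(ler_pM2l lo_gt0); apply: le_trans err _.
  by rewrite le_eqVlt; apply/orP; left; apply/eqP; field; rewrite gt_eqF.
(* If W_D = +oo, its positive coefficient makes the right-hand side +oo. *)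
- by rewrite gt0_muley ?lte_fin// addye// leey.
- by [].
Qed.

Lemma gd_S_ub (a b : R) (x : \bar R) : 0 < b -> (0 <= x)%E ->
  (forall v : gd_X D, (a%:E <= x + (b *
     (normO (fun x => gd_Pi v x - u x) +
      normO (fun x => gd_grad v x - grad u x)))%:E)%E) ->
  (a%:E <= x + b%:E * gd_S D u)%E.
Proof.
move=> b0 x0; apply: lee_affine_ereal_inf => // v.
by rewrite addr_ge0 ?L2norm_ge0.
Qed.

(** Triangle inequality through the discrete gradient of an arbitrary v. The summand 1 in the
    coefficient of S_D accounts for the distance from this gradient to that of u. *)
Lemma grad_error :
  ((normO (fun x => grad u x - gd_grad uD x))%:E <=
    (k ^+ 2 / sigma_lo)%:E * W +
    (k ^+ 2 * sigma_up / sigma_lo + 1)%:E * gd_S D u)%E.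
Proof.
have a0 : 0 <= k ^+ 2 / sigma_lo by rewrite divr_ge0 ?sqr_ge0// ltW.
have b0 : 0 <= k ^+ 2 * sigma_up / sigma_lo.
  by rewrite !mulr_ge0 ?sqr_ge0// invr_ge0 ltW.
apply: gd_S_ub => [||v]; first by rewrite ltr_wpDl.
  by rewrite mule_ge0 ?gd_max_ge0// lee_fin.
have := L2norm_dist_triangle mO (grad_L2 u) (GL2 v) (GL2 uD).
rewrite (L2norm_distC (vol R d) Omega (grad u) (gd_grad v)).
rewrite (L2norm_linearB mO GL2 Glin) -/(gd_norm (v - uD)).
have := discrete_error v.
set p := normO (fun x => gd_Pi v x - u x).
set q := normO (fun x => gd_grad v x - grad u x).
have p0 : 0 <= p by exact: L2norm_ge0.
have q0 : 0 <= q by exact: L2norm_ge0.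
move=> de tri; apply: (@le_trans _ _ ((gd_norm (v - uD))%:E + q%:E)%E).
  by rewrite -EFinD lee_fin addrC.
apply: le_trans (leeD2r _ de) _; rewrite -addeA leeD2l// -EFinD lee_fin.
by rewrite mulrDl mul1r lerD// ?ler_wpM2l ?lerDr.
Qed.

(** Triangle inequality through the reconstruction of v, the distance between the two
    reconstructions being at most c times the norm of v - uD; c will be C_D. *)
Lemma function_error (c : R) : 0 <= c ->
  (forall v : gd_X D, normO (gd_Pi v) <= c * gd_norm v) ->
  ((normO (fun x => u x - gd_Pi uD x))%:E <=
    (c * k ^+ 2 / sigma_lo)%:E * W +
    (c * k ^+ 2 * sigma_up / sigma_lo + 1)%:E * gd_S D u)%E.
Proof.
move=> c0 cP.
have a0 : 0 <= k ^+ 2 / sigma_lo by rewrite divr_ge0 ?sqr_ge0// ltW.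
have b0 : 0 <= k ^+ 2 * sigma_up / sigma_lo.
  by rewrite !mulr_ge0 ?sqr_ge0// invr_ge0 ltW.
have -> : c * k ^+ 2 / sigma_lo = c * (k ^+ 2 / sigma_lo) by rewrite !mulrA.
have -> : c * k ^+ 2 * sigma_up / sigma_lo = c * (k ^+ 2 * sigma_up / sigma_lo).
  by rewrite !mulrA.
apply: gd_S_ub => [||v]; first by rewrite ltr_wpDl// mulr_ge0.
  by rewrite mule_ge0 ?gd_max_ge0// lee_fin mulr_ge0.
have := L2norm_dist_triangle mO (H1_fun_L2 u) (PL2 v) (PL2 uD).
rewrite (L2norm_distC (vol R d) Omega u (gd_Pi v)) (L2norm_linearB mO PL2 Plin).
have := discrete_error v; have := cP (v - uD).
set p := normO (fun x => gd_Pi v x - u x).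
set q := normO (fun x => gd_grad v x - grad u x).
have p0 : 0 <= p by exact: L2norm_ge0.
have q0 : 0 <= q by exact: L2norm_ge0.
move=> ce de tri; apply: (@le_trans _ _ (c%:E * (gd_norm (v - uD))%:E + p%:E)%E).
  by rewrite -EFinM -EFinD lee_fin (le_trans tri)// addrC lerD2r.
have c0' : (0 <= c%:E)%E by rewrite lee_fin.
apply: le_trans (leeD2r _ (lee_wpmul2l c0' de)) _.
have aW : (0 <= (k ^+ 2 / sigma_lo)%:E * W)%E.
  by rewrite mule_ge0 ?gd_max_ge0// lee_fin.
have bq : (0 <= (k ^+ 2 * sigma_up / sigma_lo * q)%:E)%E.
  by rewrite lee_fin mulr_ge0.
(* As W_D may be infinite, distributivity is used in its form for nonnegative summands. *)
rewrite (ge0_muleDr c%:E aW bq).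
rewrite muleA -EFinM -addeA leeD2l// -EFinM -EFinD lee_fin.
set b := k ^+ 2 * sigma_up / sigma_lo in b0 *.
(* S_D measures p + q, but only q carries the factor c b on the left; the extra term c b p on the
   right is nonnegative. *)
have cbp := mulr_ge0 (mulr_ge0 c0 b0) p0.
by lra.
Qed.

End ErrorEstimate.

(** [K_finite] says that K_D is a genuine real number. If some nonzero v had zero discrete strain,
    K_D would be +oo and adding v to a solution would give another one. *)
Theorem theorem3p2 (R : realType) (d : nat)
  (Omega GammaD GammaN : set 'rV[R]_d)
  (F g : 'rV[R]_d -> 'rV[R]_d)
  (C : 'rV[R]_d -> tensor4 R d) (sigma_up sigma_lo : R)
  (u : H1 Omega)
  (D : gradient_discretisation Omega GammaN)
  (d_ge1 : (1 <= d)%N)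
  (Omega_connected : connected Omega) (Omega_open : open Omega)
  (Omega_lipschitz : lipschitz_boundary Omega)
  (GammaD_measurable : measurable (GammaD : set (surfT R d)))
  (GammaN_measurable : measurable (GammaN : set (surfT R d)))
  (Gamma_disjoint : GammaD `&` GammaN = set0)
  (Gamma_cover : boundary Omega = GammaD `|` GammaN)
  (GammaD_pos : (0 < surf R d GammaD)%E)
  (F_L2 : L2 (vol R d) Omega F)
  (g_L2 : L2 (surf R d) GammaN g)
  (sigma_up_gt0 : 0 < sigma_up) (sigma_lo_gt0 : 0 < sigma_lo)
  (C_elasticity : is_elasticity_tensor Omega C sigma_up sigma_lo)
  (u_solution : weak_solution GammaD GammaN C F g u)
  (K_finite : (gd_K D < +oo)%E) :
  let sigma := fun x => tapp (C x) (eps u x) in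
  Hdiv Omega GammaN sigma /\
  exists uD : gd_X D,
    [/\ unique (gradient_scheme C F g) uD,
        ((L2norm (vol R d) Omega (fun x => grad u x - gd_grad uD x)%R)%:E <=
          gd_K D ^+ 2 / sigma_lo%:E * gd_W D sigma +
          (gd_K D ^+ 2 * sigma_up%:E / sigma_lo%:E + 1) * gd_S D u)%E &
        ((L2norm (vol R d) Omega (fun x => u x - gd_Pi uD x)%R)%:E <=
          gd_C D * gd_K D ^+ 2 / sigma_lo%:E * gd_W D sigma +
          (gd_C D * gd_K D ^+ 2 * sigma_up%:E / sigma_lo%:E + 1)
            * gd_S D u)%E].
Proof.
move=> sigma.
have GammaE : boundary Omega `\` GammaN = GammaD.
  rewrite Gamma_cover setDUl setDv setU0; apply/setDidPl.
  by rewrite setIC in Gamma_disjoint *.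
have up_ge0 := ltW sigma_up_gt0.
split.
  exact: (stress_Hdiv Omega_open F_L2 g_L2 up_ge0 C_elasticity u_solution
    GammaE).
have [k KE] : exists k, gd_K D = k%:E.
  by exists (fine (gd_K D)); rewrite fineK// ge0_fin_numE// gd_max_ge0.
have mO := open_vol_measurable Omega_open.
have [uD uDP] := gradient_scheme_wellposed Omega_open GammaN_measurable
  F_L2 g_L2 up_ge0 sigma_lo_gt0 C_elasticity KE.
have [c [CE c0 cP]] := gd_C_bound D mO GammaN_measurable.
exists uD; split => //.
(* With K_D real and [sigma_lo] nonzero, the extended coefficients are embeddings of real ones. *)
- rewrite KE inver gt_eqF// -EFin_expe -!EFinM -EFinD.
  exact: (grad_error Omega_open GammaE F_L2 g_L2 up_ge0 sigma_lo_gt0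
    C_elasticity u_solution KE uDP.1).
- rewrite CE KE inver gt_eqF// -EFin_expe -!EFinM -EFinD.
  exact: (function_error Omega_open GammaE F_L2 g_L2 up_ge0 sigma_lo_gt0
    C_elasticity u_solution KE uDP.1 c0 cP).
Qed.
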